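(* Let $x_0\in\mathbb R\setminus\{0\}$, let $a\in L^1_{\mathsf{loc}}(0,\infty)$, let $f:\mathbb R\times\mathbb R\to\mathbb R$ be differentiable in its second variable $x$, and let $X_h$ be the Milstein approximation defined in the context. Assume: (1) $\limsup_{t\to\infty}\frac1t\int_0^t a(s)\,ds$ is finite; (2) there exists $h_0>0$ such that for all $0<h<h_0$, with $t_k=kh$ and $\Delta A_k=\int_{t_k}^{t_{k+1}}a(s)\,ds$, one has $\gamma_*:=\inf_{k\ge 0}\Delta A_k>-\frac12$ and $\sup_{k\ge0}\Delta A_k<+\infty$; (3) there exist positive constants $f_*,f^*$ such that for all $x\in\mathbb R\setminus\{0\}$ and $t\in\mathbb R$, $$f_*\le\frac{f(t,x)}{x}\le f^*,\qquad \max\Big\{\frac12,\frac{2}{3+2\gamma_*}\Big\}\le\frac{x\,\partial_xf(t,x)}{f(t,x)},$$ and $\frac{x\,\partial_xf(t,x)}{f(t,x)}$ is bounded above uniformly in $(t,x)$. Then there exists $0<h^*<1$ such that for all $0<h<h^*$, almost surely, $$\limsup_{n\to \infty} \frac{1}{t_n} \log |X_h(t_n)|\le \limsup_{n\to \infty} \left(\frac{1}{n}\sum_{k=0}^{n-1} \frac{\log |1+ \Delta A_k |}{h}\right)+\frac{(f^{*})^2}{2}\limsup_{n\to\infty}\frac{1}{n}\sum_{k=0}^{n-1}\frac{1}{(1+\Delta A_k)^2}-f_*^2\liminf_{n\to\infty}\frac{1}{n}\sum_{k=0}^{n-1}\frac{1}{(1+\Delta A_k)^2}+O(h)$$ and,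 almost surely, $$\liminf_{n\to \infty} \frac{1}{t_n} \log |X_h(t_n)|\ge \liminf_{n\to \infty} \left(\frac{1}{n}\sum_{k=0}^{n-1} \frac{\log |1+ \Delta A_k |}{h}\right)+\frac{f_*^{2}}{2}\liminf_{n\to\infty}\frac{1}{n}\sum_{k=0}^{n-1}\frac{1}{(1+\Delta A_k)^2}-(f^{*})^2\limsup_{n\to\infty}\frac{1}{n}\sum_{k=0}^{n-1}\frac{1}{(1+\Delta A_k)^2}+O(h^{1/2}).$$
   Context: $W$ is a standard one-dimensional Brownian motion on a filtered probability space $(\Omega,\mathcal F,\mathbb F,\mathbb P)$. For a step size $h>0$ put $t_n=nh$ ($n=0,1,2,\dots$), $\Delta W_n=W(t_{n+1})-W(t_n)$, $\Delta A_n=\int_{t_n}^{t_{n+1}}a(s)\,ds$. The Milstein scheme for the nonlinear non-autonomous SDE $dX(t)=a(t)X(t)\,dt+f(t,X(t))\,dW(t)$, $X(0)=x_0$, is $X_h(0)=x_0$ and $$X_h(t_{n+1})=X_h(t_n)\left[1+\Delta A_n+\frac{f(t_n,X_h(t_n))}{X_h(t_n)}\Delta W_n+\frac12\,\frac{f(t_n,X_h(t_n))\,\partial_xf(t_n,X_h(t_n))}{X_h(t_n)}\big[(\Delta W_n)^2-h\big]\right].$$ The number $\gamma_*$ depends on $h$; condition (3) is understood for the step sizes $h\in(0,h_0)$ under consideration. $O(h^q)$ denotes a deterministic quantity bounded in absolute value by $Ch^q$ with $C$ independent of $h$ (for small $h$) and of $n,k$. *)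

(* Defs.v *)
From HB Require Import structures.
From mathcomp Require Import all_boot all_order all_algebra.
From mathcomp Require Import all_classical all_reals all_analysis.

Set Implicit Arguments.
Unset Strict Implicit.
Unset Printing Implicit Defensive.

Import Order.TTheory GRing.Theory Num.Theory.
Import numFieldNormedType.Exports.
Local Open Scope classical_set_scope.
Local Open Scope ring_scope.

(* Time is [0, +oo[; values at negative times are irrelevant. *)
Definition is_filtration (R : realType) (d : measure_display)
    (Omega : measurableType d) (F : R -> set (set Omega)) : Prop :=
  [/\ forall t : R, 0 <= t -> sigma_algebra [set: Omega] (F t),
      forall t : R, 0 <= t -> F t `<=` measurable
    & forall s t : R, 0 <= s -> s <= t -> F s `<=` F t].

(* The second argument of normal_prob is the standard deviation. *)
Definition is_brownian_motion (R : realType) (d : measure_display)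
    (Omega : measurableType d) (P : probability Omega R)
    (F : R -> set (set Omega)) (W : R -> Omega -> R) : Prop :=
  [/\ (forall t : R, 0 <= t -> forall B : set R, measurable B -> F t (W t @^-1` B)),
      {ae P, forall w, W 0 w = 0},
      {ae P, forall w, {within `[0, +oo[, continuous (fun t => W t w)}},
      (forall s t : R, 0 <= s -> s < t -> forall B : set R, measurable B ->
         P ((W t \- W s)%R @^-1` B) = normal_prob 0 (Num.sqrt (t - s)) B)
    & (forall s t : R, 0 <= s -> s < t ->
         forall (A : set Omega) (B : set R), F s A -> measurable B ->
         P (A `&` (W t \- W s)%R @^-1` B) =
           (P A * P ((W t \- W s)%R @^-1` B))%E)].

Definition grid (R : realType) (h : R) (n : nat) : R := n%:R * h.

Definition dW (R : realType) (Omega : Type) (W : R -> Omega -> R)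
    (h : R) (n : nat) (w : Omega) : R :=
  W (grid h n.+1) w - W (grid h n) w.

Definition dA (R : realType) (a : R -> R) (h : R) (n : nat) : R :=
  \int[lebesgue_measure]_(s in `[grid h n, grid h n.+1]) a s.

(* Meaningful only when the range is bounded below. *)
Definition gamma_star (R : realType) (a : R -> R) (h : R) : R :=
  inf (range (dA a h)).

Definition partial_x (R : realType) (f : R -> R -> R) (t x : R) : R :=
  derive1 (f t) x.

Fixpoint milstein (R : realType) (Omega : Type) (a : R -> R)
    (f : R -> R -> R) (W : R -> Omega -> R) (x0 h : R) (n : nat) (w : Omega)
    : R :=
  if n is m.+1 then
    let X := milstein a f W x0 h m w in
    let t := grid h m in
    X * (1 + dA a h m + f t X / X * dW W h m w
         + 2^-1 * (f t X * partial_x f t X / X) * (dW W h m w ^+ 2 - h))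
  else x0.

(* lne 0 = -oo, so no convention on log 0 enters here. *)
Definition milstein_exponent (R : realType) (Omega : Type) (a : R -> R)
    (f : R -> R -> R) (W : R -> Omega -> R) (x0 h : R) (w : Omega) (n : nat)
    : \bar R :=
  (((grid h n)^-1)%:E * lne (`|milstein a f W x0 h n w|%:E))%E.

Definition mean_log (R : realType) (a : R -> R) (h : R) (n : nat) : \bar R :=
  (n%:R^-1 * \sum_(0 <= k < n) (ln `|1 + dA a h k| / h))%:E.

Definition mean_inv_sq (R : realType) (a : R -> R) (h : R) (n : nat)
    : \bar R :=
  (n%:R^-1 * \sum_(0 <= k < n) ((1 + dA a h k) ^+ 2)^-1)%:E.

(* Main.v *)
Require Import Defs.
From HB Require Import structures.
From mathcomp Require Import all_boot all_order all_algebra.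
From mathcomp Require Import all_classical all_reals all_analysis.
From mathcomp Require Import measurable_realfun.
From mathcomp Require Import ring lra.

Set Implicit Arguments.
Unset Strict Implicit.
Unset Printing Implicit Defensive.

Import Order.TTheory GRing.Theory Num.Theory.
Import numFieldNormedType.Exports.
Local Open Scope classical_set_scope.
Local Open Scope ring_scope.

(** Write [c_k = 1 + dA_k]. One step of the scheme multiplies [X_h(t_k)] by
    [c_k * q_k], where [q_k = 1 + u s + v (s^2 - h)], the increment [s] of the
    Brownian motion is independent of the past and normal of variance [h], and,
    with [x = X_h(t_k)] and [f] taken at [(t_k, x)],
    [u = f / (x c_k)] and [v = f (d_x f) / (2 x c_k)] are functions of the past.
    Since [s] is centred, the expansion of the logarithm gives
    [E (log |q_k| | past) = - u^2 h / 2 + O(h^2)], and [u] lies between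
    [f_* / c_k] and [f^* / c_k]. Hence [log |X_h(t_n)| / t_n] should be, up to
    the announced error, at most the mean of [log c_k / h] minus [f_*^2 / 2]
    times the mean of [1 / c_k^2], and at least the same expression with [f^*].
    Both are stronger than the claim, because [f_* <= f^*] and the upper limit
    of a mean is at least its lower limit.

    To pass from conditional expectations to almost sure statements, the
    powers [|q|^h] and [|q|^(-h)] replace the logarithm. Their conditional
    expectations are at most [exp (h (- u^2 h / 2 + C h^2))] and
    [exp (h (u^2 h / 2 + C h^(3/2)))] (milstein_step_upper and
    milstein_step_lower): the exponent [h] is so small that the second-order
    term [(h log |q|)^2] only contributes to the error. These bounds multiply
    along the trajectory (milstein_moment_le, which rests on
    integral_freezing), and a sequence of nonnegative variables whose means
    are at most [K exp b_n] is almost surely [O(exp (b_n + delta n))]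
    for each [delta > 0] (ae_growth_bound). Taking logarithms and dividing by
    [n h^2] gives milstein_growth; the loss [delta = h^3] costs only [h].

    The negative power is delicate. The hypotheses allow [gamma_*] to tend to
    [- 1/2] as [h] tends to [0], and then they only give [u^2 <= 4 v], that is,
    [1 + u s + v s^2 >= 0], so [q] may vanish. But the zeros of [q] stay away
    from [s = 0] uniformly in [h] (milstein_factor_singular), a region where
    the normal density of variance [h] is smaller than any power of [h], and
    near them [|q|^(-1/4)] is bounded by an integrable kernel
    [|s - m|^(-1/2)]. Elsewhere everything follows from Taylor bounds, the
    symmetry of the normal law and its even moments (gaussian_even_bound). *)

(** * Upper and lower limits of extended real sequences *)

Section LimSup.
Variable R : realType.
Implicit Types (u : (\bar R)^nat) (l : R).
Local Open Scope ereal_scope.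

Lemma limn_esup_le_near u l :
  (forall e : R, (0 < e)%R -> \forall n \near \oo, u n <= (l + e)%:E) ->
  limn_esup u <= l%:E.
Proof.
move=> H; apply/lee_addgt0Pr => e e0.
have [N _ HN] := H e e0.
apply: (@le_trans _ _ (ereal_sup (u @` [set n | (N <= n)%N]))).
  by apply: ereal_inf_lbound; exists [set n | (N <= n)%N] => //; exists N.
apply: ge_ereal_sup => _ [n Nn <-]; rewrite -EFinD; exact: HN.
Qed.

Lemma limn_esup_lt_near u x : limn_esup u < x ->
  \forall n \near \oo, u n < x.
Proof.
move=> /ereal_inf_lt [_ [A Aoo <-] Ax].
apply: filterS Aoo => n An; apply: le_lt_trans Ax.
by apply: ereal_sup_ubound; exists n.
Qed.

Lemma limn_einf_gt_near u x : x < limn_einf u ->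
  \forall n \near \oo, x < u n.
Proof.
rewrite /limn_einf lteNr => /limn_esup_lt_near.
by apply: filterS => n; rewrite lteN2.
Qed.

Lemma limn_einf_ge_near u l :
  (forall e : R, (0 < e)%R -> \forall n \near \oo, (l - e)%:E <= u n) ->
  l%:E <= limn_einf u.
Proof.
move=> H; rewrite /limn_einf leeNr -EFinN; apply: limn_esup_le_near => e e0.
apply: filterS (H e e0) => n; by rewrite leeNl -EFinN opprD opprK.
Qed.

Lemma limn_esup_fin_num u l1 l2 : (forall n, l1%:E <= u n) ->
  (forall n, u n <= l2%:E) -> limn_esup u \is a fin_num.
Proof.
move=> h1 h2; rewrite fin_real//; apply/andP; split.
- apply: (@lt_le_trans _ _ l1%:E); first by rewrite ltNyr.
  rewrite (le_trans _ (limn_einf_sup u))//.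
  apply: limn_einf_ge_near => e e0; apply: nearW => n.
  by rewrite (le_trans _ (h1 n))// lee_fin gerBl ltW.
- apply: (@le_lt_trans _ _ l2%:E); last by rewrite ltry.
  apply: limn_esup_le_near => e e0; apply: nearW => n.
  by rewrite (le_trans (h2 n))// lee_fin lerDl ltW.
Qed.

Lemma limn_einf_fin_num u l1 l2 : (forall n, l1%:E <= u n) ->
  (forall n, u n <= l2%:E) -> limn_einf u \is a fin_num.
Proof.
move=> h1 h2; rewrite /limn_einf fin_numN.
apply: (@limn_esup_fin_num _ (- l2) (- l1)) => n; rewrite EFinN leeN2 //.
Qed.
End LimSup.

(** * Bounds for small powers of |1 + x| *)

Section Scalar.
Variable R : realType.
Implicit Types x y t l : R.

(** Inverting [1 - t <= expR (- t)] gives [expR t <= 1 / (1 - t)], which the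
    quadratic dominates as long as [1 - 2 t >= 0]. *)
Lemma expR_le_quad t : t <= 2^-1 -> expR t <= 1 + t + 2 * t ^+ 2.
Proof.
move=> t12.
have h1 : 1 - t <= expR (- t) by exact: expR_ge1Dx.
have h2 := expR_gt0 t.
have h3 := expRxMexpNx_1 t.
have h4 : expR t * (1 - t) <= 1 by rewrite -[leRHS]h3 ler_pM2l.
have h5 : 0 < 1 - t by lra.
rewrite -(ler_pM2r h5); apply: (le_trans h4).
have h6 : 0 <= 1 - 2 * t by lra.
have h7 : 0 <= t ^+ 2 by exact: sqr_ge0.
have h8 := mulr_ge0 h7 h6.
by nra.
Qed.

(** One application of the mean value theorem, on either side of [0]: the sign
    condition [0 <= g y * x] covers [x >= 0] and [x <= 0] at the same time. *)
Lemma ge0_of_derive (G g : R -> R) x : G 0 = 0 ->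
  (forall y, Num.min 0 x <= y <= Num.max 0 x -> is_derive y 1 G (g y) /\ 0 <= g y * x) ->
  0 <= G x.
Proof.
move=> G0 H.
have dG y : y \in `[Num.min 0 x, Num.max 0 x] -> is_derive y 1 G (g y).
  by rewrite in_itv/= => /H[].
have cG : {within `[Num.min 0 x, Num.max 0 x], continuous G}.
  by apply: derivable_within_continuous => y /dG ?; exact: ex_derive.
have [|c cI] := MVT_segment _ (fun y yI => dG y (subset_itv_oo_cc yI)) cG.
  by rewrite ge_min !le_max lexx.
move: cI; rewrite in_itv/= => /H[_ gx].
have [x0|x0] := leP 0 x; rewrite G0.
  by rewrite !subr0 => ->.
by rewrite !sub0r mulrN => /oppr_inj ->.
Qed.

(** The difference of the two sides has derivative [y^3 / (1 + y)], of the sign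
    of [y]. *)
Lemma ln1D_le_cubic x : - 2^-1 <= x ->
  ln (1 + x) <= x - x ^+ 2 / 2 + x ^+ 3 / 3.
Proof.
move=> xl; rewrite -subr_ge0.
apply: (@ge0_of_derive (fun x => x - x ^+ 2 / 2 + x ^+ 3 / 3 - ln (1 + x)) (fun y => y ^+ 3 / (1 + y))).
  by rewrite !expr0n/= !mul0r !addr0 ln1 !subr0.
move=> y /andP[ly uy].
have p : 0 < 1 + y.
  by move: ly; rewrite ge_min => /orP[|] ly; lra.
split.
  have := is_derive1_ln p.
  move=> ?.
  apply: is_derive_eq.
  rewrite /GRing.scale/= /GRing.scale/=. 
  by field; rewrite gt_eqF.
have : 0 <= y * x.
  have [x0|x0] := leP 0 x.
    by move: ly; rewrite min_l// => ly; rewrite mulr_ge0.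
  by move: uy; rewrite max_l ?(ltW x0)// => uy; rewrite mulr_le0// ltW.
rewrite (_ : y ^+ 3 / (1 + y) * x = y ^+ 2 * (y * x) / (1 + y)); last by ring.
by move=> yx; exact: divr_ge0 (mulr_ge0 (sqr_ge0 _) yx) (ltW p).
Qed.

(** For [x >= 0] the quadratic Taylor polynomial is already a lower bound; for
    [x < 0] the derivative of the error, [y^2 / (1 + y)], is at most [2 y^2]. *)
Lemma ln1D_ge x : - 2^-1 <= x ->
  x - x ^+ 2 / 2 - `|x| ^+ 3 <= ln (1 + x).
Proof.
move=> xl; rewrite -subr_ge0.
have [x0|x0] := leP 0 x.
  apply: (@le_trans _ _ (ln (1 + x) - x + x ^+ 2 / 2)); last first.
    have : 0 <= `|x| ^+ 3 by rewrite exprn_ge0.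
    by lra.
  apply: (@ge0_of_derive (fun x => ln (1 + x) - x + x ^+ 2 / 2)
    (fun y => y ^+ 2 / (1 + y))).
    by rewrite !expr0n/= !mul0r !addr0 ln1 !subr0.
  move=> y; rewrite min_l// max_r// => /andP[ly uy].
  have p : 0 < 1 + y by lra.
  split; last by rewrite mulr_ge0// divr_ge0 ?sqr_ge0// ltW.
  have := is_derive1_ln p => ?.
  apply: is_derive_eq.
  rewrite /GRing.scale/= /GRing.scale/=.
  by field; rewrite gt_eqF.
apply: (@le_trans _ _ (ln (1 + x) - x + x ^+ 2 / 2 - x ^+ 3)); last first.
  rewrite ltr0_norm// exprNn -signr_odd/= expr1 mulN1r; lra.
apply: (@ge0_of_derive (fun x => ln (1 + x) - x + x ^+ 2 / 2 - x ^+ 3)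
    (fun y => y ^+ 2 / (1 + y) - 3 * y ^+ 2)).
  by rewrite !expr0n/= !mul0r !addr0 ln1 !subr0.
move=> y; rewrite min_r ?max_l ?(ltW x0)// => /andP[ly uy].
have p : 0 < 1 + y by lra.
split.
  have := is_derive1_ln p => ?.
  apply: is_derive_eq.
  rewrite /GRing.scale/= /GRing.scale/=.
  by field; rewrite gt_eqF.
rewrite mulr_le0 ?(ltW x0)// subr_le0 mulrC ler_wpM2r ?sqr_ge0//.
by rewrite -[leRHS]invrK lef_pV2 ?posrE//; lra.
Qed.

Lemma ln1D_sqr_le x : - 2^-1 <= x <= 2^-1 -> (ln (1 + x)) ^+ 2 <= 4 * x ^+ 2.
Proof.
move=> /andP[xl xu].
have p : 0 < 1 + x by lra.
have h1 : ln (1 + x) <= x by apply: le_ln1Dx; lra.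
have h2 : - ln (1 + x) <= - (x / (1 + x)).
  rewrite -lnV ?posrE//.
  have e : (1 + x)^-1 = 1 + (- (x / (1 + x))).
    by field; rewrite gt_eqF.
  rewrite [in leLHS]e.
  apply: le_ln1Dx. rewrite ltrN2 ltr_pdivrMr//; lra.
have h3 : `|x / (1 + x)| <= 2 * `|x|.
  rewrite normrM normfV (gtr0_norm p) ler_pdivrMr// -mulrA mulrCA ler_peMr//; lra.
have : `|ln (1 + x)| <= 2 * `|x|.
  rewrite ler_norml; apply/andP; split.
    rewrite lerNl (le_trans h2)// (le_trans (ler_norm _))// normrN; exact: h3.
  by rewrite (le_trans h1)// (le_trans (ler_norm _))// ler_peMl//; lra.
move=> h; rewrite -(real_normK (num_real (ln _))) -(real_normK (num_real x)).
have := normr_ge0 (ln (1+x)); nra.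
Qed.

(** Bernoulli's inequality, as Young's inequality for the product of
    [(1 + t)^l] and [1] with the exponents [1 / l] and [1 / (1 - l)]. *)
Lemma bernoulli_powR t l : 0 <= t -> 0 < l < 1 -> (1 + t) `^ l <= 1 + l * t.
Proof.
move=> t0 /andP[l0 l1].
have p0 : 0 < 1 - l by lra.
have := @conjugate_powR R ((1 + t) `^ l) 1 l^-1 (1 - l)^-1 (powR_ge0 _ _) ler01.
rewrite !invr_gt0 l0 p0 !invrK subrKC => /(_ isT isT erefl).
rewrite mulr1 -powRrM divff ?gt_eqF// powRr1 ?powR1; last by lra.
by lra.
Qed.

(** For [|x| <= 1/2] this is the cubic Taylor bound of [ln (1 + x)] put into
    [expR]. For larger [|x|] the fourth power dominates all that [1 + l |x|]
    can be, so that no case distinction on the sign of [1 + x] remains. *)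
Lemma powR_norm1D_le x l : 0 < l <= 2^-1 ->
  `|1 + x| `^ l <=
    1 + l * (x - x ^+ 2 / 2 + x ^+ 3 / 3 + 20 * x ^+ 4) + 8 * l ^+ 2 * x ^+ 2.
Proof.
move=> /andP[l0 l1].
have x4 : 0 <= x ^+ 4 by rewrite exprn_even_ge0.
have x2 : 0 <= x ^+ 2 by rewrite sqr_ge0.
have [xs|xb] := leP `|x| 2^-1.
  move: xs; rewrite ler_norml => /andP[xl xu].
  have p : 0 < 1 + x by lra.
  rewrite gtr0_norm// /powR gt_eqF//.
  have h1 : ln (1 + x) <= x by apply: le_ln1Dx; lra.
  have h2 := ln1D_le_cubic xl.
  have h3 : ln (1 + x) ^+ 2 <= 4 * x ^+ 2 by apply: ln1D_sqr_le; rewrite xl.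
  have h4 : l * ln (1 + x) <= 2^-1.
    have : ln (1 + x) <= 2^-1 by lra.
    by nra.
  apply: (le_trans (expR_le_quad h4)).
  have h5 : l * ln (1 + x) <= l * (x - x ^+ 2 / 2 + x ^+ 3 / 3).
    by rewrite ler_pM2l.
  have h6 : l ^+ 2 * ln (1 + x) ^+ 2 <= l ^+ 2 * (4 * x ^+ 2).
    by rewrite ler_wpM2l ?sqr_ge0.
  have h7 : 0 <= l * x ^+ 4 by rewrite mulr_ge0// ltW.
  by rewrite exprMn; lra.
have h1 : `|1 + x| `^ l <= 1 + l * `|x|.
  apply: (@le_trans _ _ ((1 + `|x|) `^ l)).
    apply: ge0_ler_powR; rewrite ?nnegrE//; first exact: ltW.
    by rewrite (le_trans (ler_normD _ _))// normr1.
  apply: bernoulli_powR => //; rewrite l0; lra.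
apply: (le_trans h1).
have h0 : 0 <= l ^+ 2 * x ^+ 2 by rewrite mulr_ge0 ?sqr_ge0.
suff h2 : `|x| <= x - x ^+ 2 / 2 + x ^+ 3 / 3 + 20 * x ^+ 4.
  have : l * `|x| <= l * (x - x ^+ 2 / 2 + x ^+ 3 / 3 + 20 * x ^+ 4).
    by rewrite ler_pM2l.
  by lra.
have e2 : x ^+ 2 = `|x| ^+ 2 by rewrite real_normK// num_real.
have e4 : x ^+ 4 = `|x| ^+ 4 by rewrite (exprM _ 2 2) e2 -exprM.
have e3 : - `|x| ^+ 3 <= x ^+ 3 by rewrite lerNl -normrX -normrN ler_norm.
have e1 : - `|x| <= x by rewrite lerNl -normrN ler_norm.
rewrite e4 e2; move: e3 e1 xb; set z := `|x|; set w := x ^+ 3 => e3 e1 xb.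
have q1 : z <= 8 * z ^+ 4.
  have : 8^-1 <= z ^+ 3.
    rewrite (_ : 8^-1 = 2^-1 ^+ 3); last by field.
    by rewrite lerXn2r ?nnegrE//; lra.
  by nra.
have q2 : z ^+ 2 <= 4 * z ^+ 4 by nra.
have z0 : 0 <= z by exact: normr_ge0.
have z3 : 0 <= z ^+ 3 by rewrite exprn_ge0.
have q3 : z ^+ 3 <= 2 * z ^+ 4 by rewrite [z ^+ 4]exprS; nra.
by lra.
Qed.

(** The only part of [a^(- l)] that no polynomial in [1 - a] controls; the
    exponent [- 1/4], independent of [l], still gives an integrable function
    when [a] is a quadratic polynomial with a double root. *)
Definition singular_part (a : R) : R :=
  if a < 2^-1 then a `^ (- 4^-1) else 0.

(** Where [|1 + x| >= 1/2] the logarithm has a Taylor bound. Where [1 + x] is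
    small, [a^(- l) - 1 <= l z expR (l z)] with [z = - ln a], and [z] is at most
    [8 expR (z / 8)]: the factor [l] survives in front of a fixed power. *)
Lemma powRN_norm1D_le x l : 0 < l <= 8^-1 ->
  `|1 + x| `^ (- l) <=
    1 + l * (- x + x ^+ 2 / 2 + 16 * `|x| ^+ 3) + 8 * l ^+ 2 * x ^+ 2
    + 8 * l * singular_part `|1 + x|.
Proof.
move=> /andP[l0 l1].
have x3 : 0 <= l * `|x| ^+ 3 by rewrite mulr_ge0 ?exprn_ge0// ltW.
have x2 : 0 <= x ^+ 2 by rewrite sqr_ge0.
have lx2 : 0 <= l ^+ 2 * x ^+ 2 by rewrite mulr_ge0// sqr_ge0.
have s0 : 0 <= l * singular_part `|1 + x|.
  rewrite /singular_part; case: ifP => _; rewrite mulr_ge0 ?powR_ge0//; exact: ltW.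
have [xs|xb] := leP `|x| 2^-1.
  move: xs; rewrite ler_norml => /andP[xl xu].
  have p : 0 < 1 + x by lra.
  rewrite gtr0_norm// {1}/powR gt_eqF//.
  have h2 := ln1D_ge xl.
  have h3 : ln (1 + x) ^+ 2 <= 4 * x ^+ 2 by apply: ln1D_sqr_le; rewrite xl.
  have h4 : - l * ln (1 + x) <= 2^-1.
    have : - 1 <= ln (1 + x).
      have : x ^+ 2 <= 4^-1 by nra.
      by move=> ?; nra.
    by nra.
  apply: (le_trans (expR_le_quad h4)).
  have h5 : l * (x - x ^+ 2 / 2 - `|x| ^+ 3) <= l * ln (1 + x).
    by rewrite ler_pM2l.
  have h6 : l ^+ 2 * ln (1 + x) ^+ 2 <= l ^+ 2 * (4 * x ^+ 2).
    by rewrite ler_wpM2l ?sqr_ge0.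
  by rewrite exprMn sqrrN; move: s0; rewrite gtr0_norm//; lra.
have [x0|x0] := ltP 0 x.
  have xb' : 2^-1 < x by rewrite -(gtr0_norm x0).
  apply: (@le_trans _ _ 1).
    rewrite ger0_norm ?powRN; last by lra.
    by rewrite invf_le1 ?powR_gt0 ?(le_trans _ (ler_powR _ (ltW l0))) ?powRr0//; lra.
  have : 0 <= l * (- x + x ^+ 2 / 2 + 16 * `|x| ^+ 3).
    rewrite gtr0_norm//; apply: mulr_ge0; first exact: ltW.
    have : 4^-1 <= x ^+ 2 by nra.
    by nra.
  by lra.
have xb' : x < - 2^-1 by move: xb; rewrite ler0_norm//; lra.
have lx0 : 0 <= l * (- x + x ^+ 2 / 2) by rewrite mulr_ge0 ?ltW//; lra.
have [y0|y0] := eqVneq (1 + x) 0.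
  rewrite y0 normr0 powR0; last by rewrite oppr_eq0 gt_eqF.
  by move: s0; rewrite y0 normr0; lra.
have p : 0 < `|1 + x| by rewrite normr_gt0.
move: p s0; set a := `|1 + x| => p s0.
have aE r : a `^ (- r) = expR (r * - ln a).
  by rewrite /powR gt_eqF// mulNr mulrN.
have [a2|a2] := ltP a 2^-1; last first.
  have la : - ln a <= 1.
    rewrite -lnV ?posrE// (_ : a^-1 = 1 + (a^-1 - 1)); last by ring.
    have : a^-1 <= 2 by rewrite -[leRHS]invrK lef_pV2 ?posrE//; lra.
    move=> h; apply: (@le_trans _ _ (a^-1 - 1)); last by lra.
    by apply: le_ln1Dx; rewrite ltrBrDl subrr invr_gt0.
  have h4 : l * - ln a <= l by rewrite ler_piMr// ltW.
  rewrite aE; apply: (@le_trans _ _ (expR l)); first by rewrite ler_expR.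
  have l2 : l <= 2^-1 by lra.
  apply: (le_trans (expR_le_quad l2)).
  have : 8^-1 <= `|x| ^+ 3.
    rewrite (_ : 8^-1 = 2^-1 ^+ 3); last by field.
    by rewrite lerXn2r ?nnegrE//; lra.
  by nra.
rewrite /singular_part a2 !aE.
have z0 : 0 <= - ln a by rewrite oppr_ge0 ln_le0//; lra.
move: z0; set z := - ln a => z0.
have e1 : expR (l * z) <= 1 + l * z * expR (l * z).
  have := expR_ge1Dx (- (l * z)).
  have := expRxMexpNx_1 (l * z); have := expR_gt0 (l * z); nra.
have e2 : z <= 8 * expR (z / 8).
  have := expR_ge1Dx (z / 8); lra.
have e3 : expR (l * z) <= expR (z / 8).
  by rewrite ler_expR mulrC ler_wpM2l.
have e4 : expR (4^-1 * z) = expR (z / 8) * expR (z / 8).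
  by rewrite -expRD; congr expR; field.
apply: (le_trans e1).
have : z * expR (l * z) <= 8 * expR (4^-1 * z).
  rewrite e4 mulrA; apply: ler_pM => //; exact: expR_ge0.
move=> /(ler_wpM2l (ltW l0)); rewrite mulrA.
by lra.
Qed.
End Scalar.

(** * Integrals against the centred normal law *)

Section Gaussian.
Variable R : realType.
Local Notation mu := (@lebesgue_measure R).
Local Open Scope ereal_scope.

(** The density is almost everywhere the Radon-Nikodym derivative, both having
    the same integrals over measurable sets. *)
Lemma ge0_integral_normal_prob (m sigma : R) (f : R -> \bar R) : sigma != 0%R ->
  (forall x, 0 <= f x) -> measurable_fun [set: R] f ->
  \int[normal_prob m sigma]_x f x = \int[mu]_x (f x * (normal_pdf m sigma x)%:E).
Proof.
move=> s0 f0 mf.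
have dom := normal_prob_dominates m sigma.
rewrite -(Radon_Nikodym_SigmaFinite.change_of_variables dom)//.
have mp : measurable_fun [set: R] (fun x => (normal_pdf m sigma x)%:E).
  by apply/measurable_EFinP; exact: measurable_normal_pdf.
have mrn : measurable_fun [set: R] (Radon_Nikodym_SigmaFinite.f (normal_prob m sigma) mu).
  exact: measurable_int (Radon_Nikodym_SigmaFinite.f_integrable dom).
apply: ge0_ae_eq_integral => //.
- exact: emeasurable_funM.
- exact: emeasurable_funM.
- by move=> x _; rewrite mule_ge0//; exact: (Radon_Nikodym_SigmaFinite.f_ge0 dom).
- by move=> x _; rewrite mule_ge0// lee_fin normal_pdf_ge0.
apply: ae_eqe_mul2l.
apply: integral_ae_eq => //.
  exact: (Radon_Nikodym_SigmaFinite.f_integrable dom).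
move=> E _ mE.
by rewrite -Radon_Nikodym_SigmaFinite.f_integral.
Qed.

Lemma ge0_integral_lebesgueN (g : R -> \bar R) :
  (forall x, 0 <= g x) -> measurable_fun [set: R] g ->
  \int[mu]_x g (- x)%R = \int[mu]_x g x.
Proof.
move=> g0 mg.
transitivity (\int[pushforward mu (-%R : _ -> measurableTypeR R)]_x g x).
  by rewrite ge0_integral_pushforward.
by apply: eq_measure_integral => A mA _; exact: lebesgue_measureN.
Qed.

Lemma normal_pdf_even (sigma x : R) : sigma != 0%R ->
  normal_pdf 0 sigma (- x) = normal_pdf 0 sigma x.
Proof.
by move=> s0; rewrite normal_pdfE// /normal_pdf /normal_fun !subr0 sqrrN.
Qed.

Lemma ge0_integral_normal_probN (sigma : R) (f : R -> \bar R) : sigma != 0%R ->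
  (forall x, 0 <= f x) -> measurable_fun [set: R] f ->
  \int[normal_prob 0 sigma]_x f (- x)%R = \int[normal_prob 0 sigma]_x f x.
Proof.
move=> s0 f0 mf.
rewrite !ge0_integral_normal_prob//; last first.
  by apply: measurableT_comp => //; exact: oppr_measurable.
rewrite -[RHS]ge0_integral_lebesgueN.
- by apply: eq_integral => x _; rewrite normal_pdf_even.
- by move=> x; rewrite mule_ge0// lee_fin normal_pdf_ge0.
- apply: emeasurable_funM => //.
  by apply/measurable_EFinP; exact: measurable_normal_pdf.
Qed.

(** Multiplying the normal density of variance [h] by [expR (k s^2)] gives, up to
    a constant, the normal density of variance [h / (1 - 2 k h)]. All the
    moments below are read off from this one integral. *)
Lemma integral_expR_sqr (h k : R) : (0 < h)%R -> (0 < 1 - 2 * k * h)%R ->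
  \int[normal_prob 0 (Num.sqrt h)]_s (expR (k * s ^+ 2))%:E
    = (Num.sqrt (1 - 2 * k * h))^-1%:E.
Proof.
move=> h0 c0.
have [c cE] : {c : R | c = 1 - 2 * k * h}%R by eexists.
rewrite -cE in c0 *.
have sh0 : Num.sqrt h != 0%R by rewrite gt_eqF// sqrtr_gt0.
have hc : (0 < h / c)%R by rewrite divr_gt0.
have shc0 : Num.sqrt (h / c) != 0%R by rewrite gt_eqF// sqrtr_gt0.
rewrite ge0_integral_normal_prob//; last first.
  apply/measurable_EFinP; apply: measurableT_comp => //.
  by apply: measurable_funM => //; exact: measurable_funX.
transitivity (\int[mu]_s ((Num.sqrt c)^-1%:E * (normal_pdf 0 (Num.sqrt (h / c)) s)%:E)).
  apply: eq_integral => s _; rewrite -!EFinM; congr EFin.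
  rewrite !normal_pdfE// /normal_pdf /normal_peak /normal_fun !subr0.
  rewrite !sqr_sqrtr ?ltW// [LHS]mulrCA -expRD [RHS]mulrA; congr (_ * expR _)%R.
    rewrite -invfM; congr (_^-1)%R.
    rewrite -sqrtrM ?ltW//; congr Num.sqrt.
    by move: (@pi R) => p; rewrite mulrnAr mulrA [(c * _)%R]mulrC divfK// gt_eqF.
  rewrite !mulr2n (_ : k = (1 - c) / (2 * h))%R; last first.
    by rewrite cE; field; rewrite gt_eqF.
  clear cE hc shc0; field.
  by rewrite !gt_eqF// addr_gt0.
rewrite ge0_integralZl//.
- by rewrite integral_normal_pdf mule1.
- by apply/measurable_EFinP; exact: measurable_normal_pdf.
- by move=> x _; rewrite lee_fin normal_pdf_ge0.
Qed.
End Gaussian.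

(** * Even moments of the centred normal law *)

Section GaussianMoments.
Variables (R : realType) (h : R).
Hypothesis h0 : 0 < h.
Local Notation N := (normal_prob 0 (Num.sqrt h)).

Lemma sqrt_step_neq0 : Num.sqrt h != 0.
Proof. by rewrite gt_eqF// sqrtr_gt0. Qed.

Lemma integral_normal_cst (r : R) : (\int[N]_s r%:E = r%:E)%E.
Proof.
rewrite integral_cst//; have := @probability_setT _ _ _ N => /= ->.
by rewrite mule1.
Qed.

Lemma measurable_exp_sqr (k : R) :
  measurable_fun [set: R] (fun s : R => (expR (k * s ^+ 2))%:E).
Proof.
apply/measurable_EFinP; apply: measurableT_comp => //.
by apply: measurable_funM => //; exact: measurable_funX.
Qed.

Lemma integrable_expR_sqr (k : R) : 0 < 1 - 2 * k * h ->
  N.-integrable [set: R] (fun s : R => (expR (k * s ^+ 2))%:E).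
Proof.
move=> c0; apply/integrableP; split; first exact: measurable_exp_sqr.
under eq_integral do rewrite gee0_abs ?lee_fin ?expR_ge0//.
by rewrite integral_expR_sqr// ltry.
Qed.

(** A term of the exponential series, for the parameter [1 / (4 h)] for which the
    exponential moment is finite and independent of [h]. *)
Lemma even_power_le_exp n (s : R) :
  s ^+ (2 * n.+1) <= n.+1`!%:R * (4 * h) ^+ n.+1 * expR ((4 * h)^-1 * s ^+ 2).
Proof.
have y0 : 0 <= (4 * h)^-1 * s ^+ 2.
  by rewrite mulr_ge0 ?sqr_ge0// invr_ge0 mulr_ge0// ltW.
have := expR_ge1Dxn n y0; set y := _ * s ^+ 2 in y0 * => H.
have f0 : 0 < n.+1`!%:R :> R by rewrite ltr0n fact_gt0.
have H2 : y ^+ n.+1 <= n.+1`!%:R * expR y.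
  by rewrite -ler_pdivrMl// mulrC; lra.
rewrite exprM (_ : s ^+ 2 = 4 * h * y); last first.
  by rewrite /y mulrA divff ?mul1r// gt_eqF// mulr_gt0.
rewrite exprMn [leRHS](_ : _ = (4 * h) ^+ n.+1 * (n.+1`!%:R * expR y)); last first.
  by rewrite mulrCA mulrA.
by rewrite ler_wpM2l// exprn_ge0// mulr_ge0// ltW.
Qed.

Lemma quarter_sqrt_le2 : (Num.sqrt (1 - 2 * (4 * h)^-1 * h))^-1 <= 2.
Proof.
rewrite (_ : 1 - _ = 2^-1); last by field; rewrite gt_eqF.
rewrite -[leRHS]invrK lef_pV2 ?posrE ?sqrtr_gt0//.
by rewrite -ler_sqr ?nnegrE ?sqrtr_ge0// sqr_sqrtr//; lra.
Qed.

Lemma integrable_even_power n :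
  N.-integrable [set: R] (fun s : R => (s ^+ (2 * n.+1))%:E).
Proof.
have c0 : 0 < 1 - 2 * (4 * h)^-1 * h.
  by rewrite (_ : _ - _ = 2^-1) ?invr_gt0//; field; rewrite gt_eqF.
apply: le_integrable (integrableZl _ (n.+1`!%:R * (4 * h) ^+ n.+1) (integrable_expR_sqr c0)) => //.
  by apply/measurable_EFinP; exact: measurable_funX.
move=> s _; rewrite -EFinM !abse_EFin lee_fin.
rewrite ger0_norm ?exprn_even_ge0 ?oddM// (le_trans (even_power_le_exp n s))//.
exact: ler_norm.
Qed.

Lemma gaussian_even_moment_le n :
  (\int[N]_s (s ^+ (2 * n.+1))%:E <= (2 * n.+1`!%:R * (4 * h) ^+ n.+1)%:E)%E.
Proof.
have c0 : 0 < 1 - 2 * (4 * h)^-1 * h.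
  by rewrite (_ : _ - _ = 2^-1) ?invr_gt0//; field; rewrite gt_eqF.
set k := n.+1`!%:R * (4 * h) ^+ n.+1.
have k0 : 0 <= k by rewrite mulr_ge0// exprn_ge0// mulr_ge0// ltW.
apply: (@le_trans _ _ (\int[N]_s (k%:E * (expR ((4 * h)^-1 * s ^+ 2))%:E)))%E.
  apply: ge0_le_integral => //.
  - by move=> s _; rewrite lee_fin exprn_even_ge0 ?oddM.
  - by apply/measurable_EFinP; exact: measurable_funX.
  - by apply: emeasurable_funM => //; exact: measurable_exp_sqr.
  - by move=> s _; rewrite -EFinM lee_fin even_power_le_exp.
rewrite ge0_integralZl//; last exact: measurable_exp_sqr.
rewrite integral_expR_sqr// -EFinM lee_fin [leRHS](_ : _ = k * 2).
  by rewrite ler_wpM2l// quarter_sqrt_le2.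
by rewrite /k; ring.
Qed.

(** Integrating [1 + k s^2 <= expR (k s^2)] for small [k] of both signs gives
    [k (m - h) <= 4 h^2 k^2], which forces [m = h] when [k] tends to [0]. *)
Lemma gaussian_second_moment : (\int[N]_s (s ^+ 2)%:E = h%:E)%E.
Proof.
have i2 := integrable_even_power 0; rewrite muln1 in i2.
have := integrable_fin_num measurableT i2.
case E : (\int[N]_s _)%E => [m| |]// _.
congr EFin.
have key (k : R) : `|2 * k * h| <= 2^-1 -> k * (m - h) <= 4 * h ^+ 2 * k ^+ 2.
  set t := 2 * k * h; rewrite ler_norml => /andP[tl tu].
  have c0 : 0 < 1 - 2 * k * h by rewrite -/t; lra.
  have H : (\int[N]_s ((k * s ^+ 2)%:E + 1%:E) <= (Num.sqrt (1 - 2 * k * h))^-1%:E)%E.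
    rewrite -integral_expR_sqr//; apply: le_integral => //.
    - apply: integrableD => //; last exact: finite_measure_integrable_cst.
      by under eq_fun do rewrite EFinM; exact: integrableZl.
    - exact: integrable_expR_sqr.
    - by move=> s _; rewrite -EFinD lee_fin addrC; exact: expR_ge1Dx.
  move: H; rewrite integralD//; last 2 first.
  - by under eq_fun do rewrite EFinM; exact: integrableZl.
  - exact: finite_measure_integrable_cst.
  under eq_integral do rewrite EFinM.
  rewrite integralZl// E integral_normal_cst -EFinM -EFinD lee_fin.
  move=> H.
  suff H2 : (Num.sqrt (1 - t))^-1 <= 1 + t / 2 + t ^+ 2.
    have := le_trans H H2; rewrite /t => {H2}; lra.
  have p : 0 < 1 + t / 2 + t ^+ 2 by have := sqr_ge0 t; lra.
  rewrite -[leRHS]invrK lef_pV2 ?posrE ?sqrtr_gt0 ?invr_gt0//.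
  rewrite -ler_sqr ?nnegrE ?sqrtr_ge0 ?invr_ge0 ?(ltW p)// sqr_sqrtr ?(ltW c0)//.
  rewrite exprVn -[leLHS]mul1r ler_pdivrMr ?exprn_gt0//.
  have t2 : 0 <= t ^+ 2 := sqr_ge0 t.
  have t21 : t ^+ 2 <= 4^-1 by nra.
  have : 0 <= t ^+ 2 * (1 - t) by rewrite mulr_ge0//; lra.
  have : 0 <= t ^+ 2 * (4^-1 - t * t ^+ 2).
    by apply: mulr_ge0 => //; nra.
  have : 0 <= t ^+ 2 * (5 / 4 - 5 / 4 * t - 2^-1).
    apply: mulr_ge0 => //. 
    nra.
  nra.
apply/eqP; rewrite -subr_eq0 -normr_le0; apply/ler_addgt0Pr => e e0.
rewrite add0r.
have [->|mh] := eqVneq (m - h) 0; first by rewrite normr0 ltW.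
(* small enough for key to apply to k0 and - k0, and for its error to be e *)
pose k0 := Num.min ((4 * h)^-1) (e / (4 * h ^+ 2)).
have h2 : 0 < 4 * h ^+ 2 by rewrite mulr_gt0// exprn_gt0.
have k00 : 0 < k0 by rewrite lt_min invr_gt0 mulr_gt0//= divr_gt0.
have k01 : 2 * k0 * h <= 2^-1.
  have : k0 <= (4 * h)^-1 by rewrite ge_min lexx.
  rewrite -[leRHS]mul1r ler_pdivlMr ?mulr_gt0//; lra.
have k02 : k0 * (4 * h ^+ 2) <= e.
  by rewrite -ler_pdivlMr// ge_min lexx orbT.
have kh0 : 0 <= 2 * k0 * h by rewrite !mulr_ge0// ltW.
have K1 := key k0; have K2 := key (- k0).
rewrite ger0_norm// in K1; rewrite mulrN mulNr normrN ger0_norm// in K2.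
have {}K1 := K1 k01; have {}K2 := K2 k01.
have sub (z : R) : k0 * z <= 4 * h ^+ 2 * k0 ^+ 2 -> z <= e.
  move=> H; rewrite -(ler_pM2l k00); apply: (le_trans H).
  rewrite (_ : 4 * h ^+ 2 * k0 ^+ 2 = k0 * (k0 * (4 * h ^+ 2))); last by ring.
  by rewrite ler_pM2l.
rewrite ler_norml; apply/andP; split; last exact: sub.
rewrite lerNl; apply: sub; move: K2; rewrite sqrrN; lra.
Qed.

(** The normal law is symmetric, so only the even part of [g] matters; this is
    where the odd terms of a Taylor expansion disappear without having to be
    integrated. *)
Lemma gaussian_even_bound (g : R -> R) (al be ga de : R) :
  measurable_fun [set: R] g -> (forall s, 0 <= g s) -> 0 <= ga -> 0 <= de ->
  (forall s, g s + g (- s) <= 2 * (al + be * s ^+ 2 + ga * s ^+ 4 + de * s ^+ 8)) ->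
  (\int[N]_s (g s)%:E <=
     (al + be * h + 64 * ga * h ^+ 2 + 12288 * de * h ^+ 4)%:E)%E.
Proof.
move=> mg g0 ga0 de0 H.
have i2 := integrable_even_power 0; rewrite muln1 in i2.
have i4 := integrable_even_power 1; have i8 := integrable_even_power 3.
have b4 := gaussian_even_moment_le 1; have b8 := gaussian_even_moment_le 3.
rewrite (_ : 2 * 2 = 4)%N// in i4 b4; rewrite (_ : 2 * 4 = 8)%N// in i8 b8.
have ic : N.-integrable [set: R] (cst al%:E).
  exact: finite_measure_integrable_cst.
have j2 := integrableZl measurableT be i2.
have j4 := integrableZl measurableT ga i4.
have j8 := integrableZl measurableT de i8.
have k2 := integrableD measurableT ic j2.
have k4 := integrableD measurableT k2 j4.
have k8 := integrableD measurableT k4 j8.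
have f4 := integrable_fin_num measurableT i4.
have f8 := integrable_fin_num measurableT i8.
have mgE : measurable_fun [set: R] (fun s => (g s)%:E) by exact/measurable_EFinP.
have mgN : measurable_fun [set: R] (fun s => (g (- s))%:E).
  by apply/measurable_EFinP; apply: measurableT_comp => //; exact: oppr_measurable.
have E2 : (\int[N]_s ((g s)%:E + (g (- s)%R)%:E) = \int[N]_s (g s)%:E + \int[N]_s (g s)%:E)%E.
  rewrite ge0_integralD//; last 2 first.
  - by move=> s _; rewrite lee_fin.
  - by move=> s _; rewrite lee_fin.
  congr (_ + _)%E.
  apply: (ge0_integral_normal_probN sqrt_step_neq0 (f := fun s => (g s)%:E)) => //.
have P : (\int[N]_s ((g s)%:E + (g (- s)%R)%:E) <=
   \int[N]_s (2%:E * (al%:E + be%:E * (s ^+ 2)%:E + ga%:E * (s ^+ 4)%:E + de%:E * (s ^+ 8)%:E)))%E.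
  apply: ge0_le_integral => //.
  - by move=> s _; rewrite adde_ge0 ?lee_fin.
  - exact: emeasurable_funD.
  - apply: emeasurable_funM => //; repeat (apply: emeasurable_funD || apply: emeasurable_funM) => //;
    by apply/measurable_EFinP; exact: measurable_funX.
  - by move=> s _; rewrite -!EFinM -!EFinD; exact: H.
move: P; rewrite E2 (integralZl measurableT k8) (integralD measurableT k4 j8).
rewrite (integralD measurableT k2 j4) (integralD measurableT ic j2).
rewrite !integralZl// integral_normal_cst gaussian_second_moment.
move: f4 b4; case: (\int[N]_s (s ^+ 4)%:E)%E => [m4| |]// _.
move: f8 b8; case: (\int[N]_s (s ^+ 8)%:E)%E => [m8| |]// _.
rewrite !lee_fin => b8 b4.
case: (\int[N]_s (g s)%:E)%E => [G| |]; last 2 first.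
- by rewrite addye// -!EFinM -!EFinD leye_eq.
- by move=> _; rewrite leNye.
rewrite -!EFinM -!EFinD -?EFinM !lee_fin => P.
have e4 : ga * m4 <= ga * (64 * h ^+ 2).
  rewrite ler_wpM2l//; apply: (le_trans b4).
  by rewrite exprMn (_ : 2`! = 2)//; lra.
have e8 : de * m8 <= de * (12288 * h ^+ 4).
  rewrite ler_wpM2l//; apply: (le_trans b8).
  by rewrite exprMn (_ : 4`! = 24)//; lra.
have {}P : G <= al + be * h + ga * m4 + de * m8.
  by rewrite -(ler_pM2l (ltr0Sn R 1)) mulr_natl mulr2n.
apply: (le_trans P).
rewrite (_ : 64 * ga * h ^+ 2 = ga * (64 * h ^+ 2)); last by ring.
rewrite (_ : 12288 * de * h ^+ 4 = de * (12288 * h ^+ 4)); last by ring.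
exact: lerD (lerD (lexx _) e4) e8.
Qed.
End GaussianMoments.

(** * The mean of a small power of the one-step factor *)

Section OneStep.
Variable R : realType.

(** One step of the scheme multiplies the current value by [1 + dA_n] times this
    factor, for a Brownian increment [s]. *)
Definition milstein_factor (h u v s : R) : R := 1 + (u * s + v * (s ^+ 2 - h)).

Lemma measurable_milstein_factor_powR (h u v l : R) :
  measurable_fun [set: R] (fun s => `|milstein_factor h u v s| `^ l).
Proof.
apply: (@measurableT_comp _ _ _ _ _ _ (fun x : R => x `^ l)).
  exact: measurable_powR.
apply: measurableT_comp; first exact: normr_measurable.
apply: measurable_funD => //; apply: measurable_funD; apply: measurable_funM => //.
by apply: measurable_funB => //; exact: measurable_funX.
Qed.

(** The sizes of the two summands of [milstein_factor - 1], in the form that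
    gaussian_even_bound can integrate. *)
Lemma fourth_power_bounds (K h u v s : R) : 1 <= K -> 0 < h <= 1 ->
  0 <= u <= K -> 0 <= v <= K ->
  [/\ (u * s) ^+ 2 <= K ^+ 4 * s ^+ 2, (u * s) ^+ 4 <= K ^+ 4 * s ^+ 4,
      (v * (s ^+ 2 - h)) ^+ 2 <= K ^+ 4 * (s ^+ 4 + h ^+ 2) &
      (v * (s ^+ 2 - h)) ^+ 4 <= 2 * K ^+ 4 * (s ^+ 8 + h ^+ 2)].
Proof.
move=> K1 /andP[h0 h1] /andP[u0 uK] /andP[v0 vK].
have K0 : 0 <= K by lra.
have K2 : 1 <= K ^+ 2 by rewrite exprn_ege1.
have K24 : K ^+ 2 <= K ^+ 4 by rewrite ler_weXn2l.
have u2 : u ^+ 2 <= K ^+ 2 by rewrite lerXn2r ?nnegrE.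
have u4 : u ^+ 4 <= K ^+ 4 by rewrite lerXn2r ?nnegrE.
have v2 : v ^+ 2 <= K ^+ 2 by rewrite lerXn2r ?nnegrE.
have v4 : v ^+ 4 <= K ^+ 4 by rewrite lerXn2r ?nnegrE.
have s2 : 0 <= s ^+ 2 by rewrite sqr_ge0.
have s4 : 0 <= s ^+ 4 by rewrite exprn_even_ge0.
have b2 : (s ^+ 2 - h) ^+ 2 <= s ^+ 4 + h ^+ 2.
  have : 0 <= h * s ^+ 2 by rewrite mulr_ge0// ltW.
  by rewrite (_ : s ^+ 4 = (s ^+ 2) ^+ 2) -?exprM//; lra.
have h20 : 0 <= h ^+ 2 by rewrite sqr_ge0.
have b4 : (s ^+ 2 - h) ^+ 4 <= 2 * (s ^+ 8 + h ^+ 2).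
  rewrite (_ : _ ^+ 4 = ((s ^+ 2 - h) ^+ 2) ^+ 2); last by rewrite -exprM.
  have e8 : s ^+ 8 = (s ^+ 4) ^+ 2 by rewrite -exprM.
  have h4 : (h ^+ 2) ^+ 2 <= h ^+ 2.
    by rewrite -exprM ler_wiXn2l ?(ltW h0).
  apply: (@le_trans _ _ ((s ^+ 4 + h ^+ 2) ^+ 2)).
    by rewrite lerXn2r ?nnegrE ?sqr_ge0// addr_ge0.
  have := sqr_ge0 (s ^+ 4 - h ^+ 2); rewrite e8; lra.
rewrite !exprMn; split.
- by rewrite ler_wpM2r// (le_trans u2).
- by rewrite ler_wpM2r.
- by apply: ler_pM; rewrite ?sqr_ge0// (le_trans v2).
- rewrite [leRHS](_ : _ = K ^+ 4 * (2 * (s ^+ 8 + h ^+ 2))); last by ring.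
  by apply: ler_pM; rewrite ?exprn_even_ge0.
Qed.

(** It depends on [K] alone; the numerical factors add up Taylor remainders and the
    moment bounds of gaussian_even_bound. *)
Definition upper_const (K : R) : R := 12500 * (200 * K ^+ 4).

Lemma upper_const_ge0 K : 0 <= upper_const K.
Proof.
have K4 : 0 <= K ^+ 4 by rewrite exprn_even_ge0.
exact: mulr_ge0 (ler0n _ _) (mulr_ge0 (ler0n _ _) K4).
Qed.

(** With [p = u s] and [B = v (s^2 - h)] the symmetrised Taylor bound is
    [B - p^2 / 2] up to terms of order [s^4 + s^8 + h^2], and [B] has mean [0]. *)
Lemma milstein_step_upper (K h u v : R) : 1 <= K -> 0 < h <= 2^-1 ->
  0 <= u <= K -> 0 <= v <= K ->
  (\int[normal_prob 0 (Num.sqrt h)]_s (`|milstein_factor h u v s| `^ h)%:E <=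
   (expR (h * (- (u ^+ 2 * h / 2) + upper_const K * h ^+ 2)))%:E)%E.
Proof.
move=> K1 /andP[h0 h1] hu hv.
have K0 : 0 <= K by lra.
have h01 : 0 < h <= 1 by rewrite h0; lra.
have K40 : 0 <= K ^+ 4 by rewrite exprn_ge0.
set C := 200 * K ^+ 4.
have C0 : 0 <= C by rewrite mulr_ge0.
apply: (le_trans (gaussian_even_bound h0 (g := fun s => `|milstein_factor h u v s| `^ h)
  (al := 1 + h * (- v * h + C * h ^+ 2)) (be := h * (v - u ^+ 2 / 2))
  (ga := h * C) (de := h * C) _ _ _ _ _)).
- exact: measurable_milstein_factor_powR.
- by move=> s; exact: powR_ge0.
- by rewrite mulr_ge0// ltW.
- by rewrite mulr_ge0// ltW.
- move=> s; rewrite /milstein_factor sqrrN.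
  have [p2 p4 B2 B4] := fourth_power_bounds s K1 h01 hu hv.
  set p := u * s in p2 p4 *; rewrite mulrN -/p.
  set B := v * (s ^+ 2 - h) in B2 B4 *.
  have hh : 0 < h <= 2^-1 by rewrite h0.
  have e1 := powR_norm1D_le (p + B) hh; have e2 := powR_norm1D_le (- p + B) hh.
  apply: (le_trans (lerD e1 e2)).
  have E : u ^+ 2 * s ^+ 2 = p ^+ 2 by rewrite /p exprMn.
  have EB : v * s ^+ 2 = B + v * h by rewrite /B; ring.
  have Bge : 0 <= B ^+ 2 * (B - 1) ^+ 2 by rewrite mulr_ge0// sqr_ge0.
  have pB : 0 <= (p ^+ 2 - B) ^+ 2 by exact: sqr_ge0.
  have pB2 : 0 <= (p ^+ 2 - B ^+ 2) ^+ 2 by exact: sqr_ge0.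
  have hp : 0 <= (h - p ^+ 2) ^+ 2 by exact: sqr_ge0.
  have hB : h * B ^+ 2 <= B ^+ 2 by rewrite ler_piMl ?sqr_ge0//; lra.
  have K41 : 1 <= K ^+ 4 by rewrite exprn_ege1.
  have h2 : h ^+ 2 <= K ^+ 4 * h ^+ 2 by rewrite ler_peMl// sqr_ge0.
  have s40 : 0 <= K ^+ 4 * s ^+ 4 by rewrite mulr_ge0// exprn_even_ge0.
  have s80 : 0 <= K ^+ 4 * s ^+ 8 by rewrite mulr_ge0// exprn_even_ge0.
  have KK : 0 <= K ^+ 4 * h ^+ 2 by rewrite mulr_ge0// sqr_ge0.
  have main : (p + B - (p + B) ^+ 2 / 2 + (p + B) ^+ 3 / 3 + 20 * (p + B) ^+ 4
       + 8 * h * (p + B) ^+ 2)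
     + (- p + B - (- p + B) ^+ 2 / 2 + (- p + B) ^+ 3 / 3 + 20 * (- p + B) ^+ 4
       + 8 * h * (- p + B) ^+ 2)
     <= 2 * (B - p ^+ 2 / 2 + C * (s ^+ 4 + s ^+ 8 + h ^+ 2)).
    have -> : (p + B - (p + B) ^+ 2 / 2 + (p + B) ^+ 3 / 3 + 20 * (p + B) ^+ 4
       + 8 * h * (p + B) ^+ 2)
     + (- p + B - (- p + B) ^+ 2 / 2 + (- p + B) ^+ 3 / 3 + 20 * (- p + B) ^+ 4
       + 8 * h * (- p + B) ^+ 2) = 2 * B - p ^+ 2 - B ^+ 2 + 2 / 3 * B ^+ 3
       + 2 * p ^+ 2 * B + 40 * (p ^+ 4 + 6 * (p ^+ 2 * B ^+ 2) + B ^+ 4)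
       + 16 * (h * p ^+ 2) + 16 * (h * B ^+ 2) by field.
    have q1 : 2 * B ^+ 3 <= B ^+ 2 + B ^+ 4 by lra.
    have q2 : 2 * p ^+ 2 * B <= p ^+ 4 + B ^+ 2 by lra.
    have q3 : 2 * (p ^+ 2 * B ^+ 2) <= p ^+ 4 + B ^+ 4 by lra.
    have q4 : 2 * (h * p ^+ 2) <= h ^+ 2 + p ^+ 4 by lra.
    have B40 : 0 <= B ^+ 4 by rewrite exprn_even_ge0.
    have B20 : 0 <= B ^+ 2 by rewrite sqr_ge0.
    rewrite /C -[200 * _ * _]mulrA !mulrDr.
    rewrite -[2 * K ^+ 4 * _]mulrA !mulrDr in B4; rewrite mulrDr in B2.
    move: q1 q2 q3 q4 B40 B20 p4 B2 B4 hB h2 s40 s80 KK.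
    move: (B ^+ 3) (2 * p ^+ 2 * B) (p ^+ 2 * B ^+ 2) (h * p ^+ 2) (h * B ^+ 2).
    move: (K ^+ 4 * s ^+ 4) (K ^+ 4 * s ^+ 8) (K ^+ 4 * h ^+ 2) (h ^+ 2).
    move: (B ^+ 4) (p ^+ 4) (B ^+ 2) (p ^+ 2).
    by clear - R => *; lra.
  have := ler_wpM2l (ltW h0) main.
  have -> : h * (v - u ^+ 2 / 2) * s ^+ 2 = h * (B + v * h - p ^+ 2 / 2).
    by rewrite -mulrA mulrBl EB mulrAC E.
  move=> H; rewrite -subr_ge0 in H; rewrite -subr_ge0; apply: (le_trans H).
  by rewrite le_eqVlt; apply/orP; left; apply/eqP; ring.
rewrite lee_fin; apply: le_trans (expR_ge1Dx _).
have h2 : 0 <= h ^+ 2 by rewrite sqr_ge0.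
have h4 : h ^+ 4 <= h ^+ 2 by rewrite ler_wiXn2l ?(ltW h0)//; lra.
have : h * C * h ^+ 4 <= h * C * h ^+ 2.
  by rewrite ler_wpM2l// mulr_ge0// ltW.
have : 0 <= h * C * h ^+ 2 by rewrite !mulr_ge0// ltW.
rewrite /upper_const -/C.
lra.
Qed.
End OneStep.

(** * Integrals of an inverse square root singularity *)

Section Singular.
Variable R : realType.
Local Notation mu := (@lebesgue_measure R).

(** The sum over [j] of these kernels dominates [|s - m|^(- 1/2)] up to a constant
    and is integrated term by term without any improper integral. *)
Definition dyadic_kernel (m : R) (j : nat) (s : R) : R :=
  2 ^+ j * \1_(`[m - 4 ^- j, m + 4 ^- j]%classic) s.

Lemma dyadic_kernel_ge0 m j s : 0 <= dyadic_kernel m j s.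
Proof. by rewrite mulr_ge0 ?exprn_ge0. Qed.

Lemma dyadic_kernelE m j s :
  dyadic_kernel m j s = if `|s - m| <= 4 ^- j then 2 ^+ j else 0.
Proof.
rewrite /dyadic_kernel indicE mem_setE in_itv/= -ler_distl.
by case: ifPn => H; rewrite ?mulr1 ?mulr0.
Qed.

(** If [4^-(J+1) < |s - m| <= 4^-J], the kernels of index at most [J] are all
    active and add up to [2^(J+1) - 1]. *)
Lemma inv_sqrt_le_dyadic m s J : 4 ^- J < `|s - m| ->
  `|s - m| `^ (- 2^-1) <= 1 + \sum_(0 <= j < J) dyadic_kernel m j s.
Proof.
elim: J => [|J IH] H.
  have {}H : 1 < `|s - m| by move: H; rewrite expr0 invr1.
  rewrite big_geq// addr0 powRN powR12_sqrt// invf_le1 ?sqrtr_gt0.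
    by rewrite -[leLHS]sqrtr1 ler_wsqrtr// ltW.
  exact: lt_trans H.
have [{}/IH IH|JH] := ltP (4 ^- J) `|s - m|.
  by rewrite big_nat_recr//= addrA (le_trans IH)// lerDl dyadic_kernel_ge0.
have -> : \sum_(0 <= j < J.+1) dyadic_kernel m j s = 2 ^+ J.+1 - 1.
  have : forall n, (n <= J.+1)%N -> \sum_(0 <= j < n) dyadic_kernel m j s = 2 ^+ n - 1.
    elim=> [|n IHn] nJ; first by rewrite big_geq// expr0 subrr.
    rewrite big_nat_recr//= IHn ?(ltnW nJ)// dyadic_kernelE ifT.
      by rewrite exprS; ring.
    apply: (le_trans JH); rewrite lef_pV2 ?posrE ?exprn_gt0//.
    by rewrite ler_weXn2l// ?ler1n.
  exact.
rewrite subrKC powRN powR12_sqrt// -[leRHS]invrK lef_pV2 ?posrE ?sqrtr_gt0 ?invr_gt0 ?exprn_gt0//.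
  rewrite -ler_sqr ?nnegrE ?sqrtr_ge0 ?invr_ge0 ?exprn_ge0// sqr_sqrtr//.
  by rewrite -exprVn -exprM mulnC exprM exprVn (_ : 2 ^+ 2 = 4) ?exprVn ?ltW//; ring.
by rewrite (lt_trans _ H)// invr_gt0 exprn_gt0.
Qed.

Lemma inv_sqrt_le_dyadic_series m s :
  ((`|s - m| `^ (- 2^-1))%:E <= 1 + \sum_(0 <= j <oo) (dyadic_kernel m j s)%:E)%E.
Proof.
have nn z : (0 <= \sum_(0 <= j <oo) (dyadic_kernel m j z)%:E)%E.
  by apply: nneseries_ge0 => j _ _; rewrite lee_fin dyadic_kernel_ge0.
have [->|sm] := eqVneq s m.
  rewrite subrr normr0 powR0 ?oppr_eq0 ?invr_eq0 ?pnatr_eq0//.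
  by apply: adde_ge0; [exact: lee01|exact: nn].
have sm0 : 0 < `|s - m| by rewrite normr_gt0 subr_eq0.
have [J HJ] : exists J, 4 ^- J < `|s - m|.
  have [J HJ] : exists J : nat, `|s - m|^-1 < J%:R.
    by exists (Num.bound `|s - m|^-1); rewrite archi_boundP// invr_ge0.
  exists J; rewrite invf_plt ?posrE ?exprn_gt0//.
  apply: (lt_le_trans HJ); rewrite -natrX ler_nat ltnW// ltn_expl//.
apply: (@le_trans _ _ (1 + \sum_(0 <= j < J) dyadic_kernel m j s)%:E).
  by rewrite lee_fin; exact: inv_sqrt_le_dyadic.
rewrite EFinD -sumEFin leeD2l//.
by apply: nneseries_lim_ge => j _ _; rewrite lee_fin dyadic_kernel_ge0.
Qed.

Lemma measurable_dyadic_kernel m j :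
  measurable_fun [set: R] (fun s => (dyadic_kernel m j s)%:E).
Proof.
by apply/measurable_EFinP; exact: measurable_funM.
Qed.

Lemma integral_dyadic_series_le m :
  (\int[mu]_s (\sum_(0 <= j <oo) (dyadic_kernel m j s)%:E) <= 4%:E)%E.
Proof.
rewrite integral_nneseries//; last 2 first.
- by move=> j; exact: measurable_dyadic_kernel.
- by move=> j s _; rewrite lee_fin dyadic_kernel_ge0.
have -> : (\sum_(0 <= j <oo) \int[mu]_s (dyadic_kernel m j s)%:E =
           \sum_(0 <= j <oo) (2 * 2 ^- j)%:E)%E.
  apply: eq_eseriesr => j _.
  under eq_integral do rewrite EFinM.
  rewrite ge0_integralZl//; last first.
    by apply/measurable_EFinP; exact: measurable_indic.
  have p : 0 < 4 ^- j :> R by rewrite invr_gt0 exprn_gt0.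
  rewrite integral_indic//= setIT lebesgue_measure_itv/= lte_fin.
  rewrite ltrBlDr -addrA ltrDl addr_gt0//.
  rewrite -EFinD (_ : m + _ - _ = 2 * 4 ^- j); last by ring.
  rewrite -EFinM; congr EFin; rewrite mulrCA; congr (_ * _).
  rewrite (_ : 4 = 2 * 2); last by ring.
  by rewrite exprMn invfM mulrA divff ?mul1r// expf_neq0.
apply: lime_le.
  by apply: is_cvg_nneseries => j _ _; rewrite lee_fin mulr_ge0// invr_ge0 exprn_ge0.
apply: nearW => n; rewrite sumEFin lee_fin.
suff -> : \sum_(0 <= i < n) 2 * 2 ^- i = 4 - 4 * 2 ^- n :> R.
  by rewrite gerBl mulr_ge0// invr_ge0 exprn_ge0.
elim: n => [|n IH]; first by rewrite big_geq// expr0 invr1 mulr1 subrr.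
by rewrite big_nat_recr//= IH exprS invfM; field; rewrite expf_neq0.
Qed.

(** Near the singularity the weight is replaced by its maximum [c], and the kernel
    has integral at most [4]; elsewhere the singular factor is at most [1]. *)
Lemma integral_inv_sqrt_le (D : R -> R) (c m : R) :
  measurable_fun [set: R] D -> (forall s, 0 <= D s <= c) ->
  (\int[mu]_s ((`|s - m| `^ (- 2^-1))%:E * (D s)%:E) <=
     \int[mu]_s (D s)%:E + (4 * c)%:E)%E.
Proof.
move=> mD Dc.
have c0 : 0 <= c by have /andP[] := Dc 0; exact: le_trans.
have D0 s : 0 <= D s by have /andP[] := Dc s.
have mDE : measurable_fun [set: R] (fun s => (D s)%:E) by exact/measurable_EFinP.
pose k s := (\sum_(0 <= j <oo) (dyadic_kernel m j s)%:E)%E.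
have k0 s : (0 <= k s)%E.
  by apply: nneseries_ge0 => j _ _; rewrite lee_fin dyadic_kernel_ge0.
have mk : measurable_fun [set: R] k.
  apply: ge0_emeasurable_sum.
    by move=> j s _ _; rewrite lee_fin dyadic_kernel_ge0.
  by move=> j _; exact: measurable_dyadic_kernel.
have mp : measurable_fun [set: R] (fun s => (`|s - m| `^ (- 2^-1))%:E).
  apply/measurable_EFinP; apply: (@measurableT_comp _ _ _ _ _ _ (fun x : R => x `^ (- 2^-1))).
    exact: measurable_powR.
  by apply: measurableT_comp; [exact: normr_measurable|exact: measurable_funB].
apply: (@le_trans _ _ (\int[mu]_s ((D s)%:E + c%:E * k s)))%E.
  apply: ge0_le_integral => //.
  - by move=> s _; rewrite mule_ge0 ?lee_fin ?powR_ge0.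
  - exact: emeasurable_funM.
  - by apply: emeasurable_funD => //; exact: emeasurable_funM.
  - move=> s _; apply: (@le_trans _ _ ((1 + k s) * (D s)%:E))%E.
      by rewrite lee_wpmul2r ?lee_fin//; exact: inv_sqrt_le_dyadic_series.
    rewrite ge0_muleDl// mul1e leeD2l// muleC lee_wpmul2r//.
    by rewrite lee_fin; have /andP[] := Dc s.
rewrite ge0_integralD//; last 3 first.
- by move=> s _; rewrite lee_fin.
- by move=> s _; rewrite mule_ge0.
- exact: emeasurable_funM.
rewrite leeD2l// ge0_integralZl// EFinM muleC lee_wpmul2r//.
exact: integral_dyadic_series_le.
Qed.
End Singular.

(** * Localisation of the zeros of the one-step factor *)

Section StepLower.
Variable R : realType.

(** The power [s^8] is absorbed by the exponential of the density at the price of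
    [h^4], which beats the normalisation [1 / sqrt h]. *)
Lemma normal_pdf_power8_le (h s : R) : 0 < h ->
  s ^+ 8 * normal_pdf 0 (Num.sqrt h) s <= 384 * h ^+ 4 / Num.sqrt h.
Proof.
move=> h0; have sh0 : 0 < Num.sqrt h by rewrite sqrtr_gt0.
rewrite normal_pdfE ?gt_eqF// /normal_pdf /normal_peak /normal_fun subr0.
rewrite !sqr_sqrtr ?(ltW h0)//.
have y0 : 0 <= s ^+ 2 / (h *+ 2) by rewrite divr_ge0 ?sqr_ge0// mulrn_wge0// ltW.
have e8 : s ^+ 8 <= 384 * h ^+ 4 * expR (s ^+ 2 / (h *+ 2)).
  have := expR_ge1Dxn 3 y0; set y := s ^+ 2 / (h *+ 2) => H.
  have -> : s ^+ 8 = 16 * h ^+ 4 * y ^+ 4.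
    by rewrite /y mulr2n; field; rewrite gt_eqF// addr_gt0.
  have f4 : 4`!%:R = 24 :> R by [].
  rewrite f4 in H.
  have {}H : y ^+ 4 <= 24 * expR y by lra.
  rewrite (_ : 384 * h ^+ 4 * expR y = 16 * h ^+ 4 * (24 * expR y)); last by ring.
  by rewrite ler_wpM2l// mulr_ge0// exprn_ge0// ltW.
have pk : (Num.sqrt (h * pi *+ 2))^-1 <= (Num.sqrt h)^-1.
  rewrite lef_pV2 ?posrE// ?sqrtr_gt0 ?mulrn_wgt0 ?mulr_gt0 ?pi_gt0//.
  apply: ler_wsqrtr; rewrite -mulrnAr ler_peMr ?ltW//.
  by have := pi_ge2 R; move: (@pi R) => p p2; rewrite mulr2n; lra.
rewrite mulrCA mulrC ler_pM ?invr_ge0 ?sqrtr_ge0//.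
  by rewrite mulr_ge0 ?expR_ge0// exprn_even_ge0.
rewrite -[leRHS]mulr1 -[X in _ <= _ * X](expRxMexpNx_1 (s ^+ 2 / (h *+ 2))) mulrA.
by rewrite mulNr ler_wpM2r// expR_ge0.
Qed.

Lemma integral_power8_singular (h m : R) : 0 < h <= 1 ->
  (\int[normal_prob 0 (Num.sqrt h)]_s (s ^+ 8 * `|s - m| `^ (- 2^-1))%:E <=
    (13824 * (h * Num.sqrt h))%:E)%E.
Proof.
move=> /andP[h0 h1]; have sh0 : 0 < Num.sqrt h by rewrite sqrtr_gt0.
have sn0 : Num.sqrt h != 0 by rewrite gt_eqF.
have m8 : measurable_fun [set: R] (fun s : R => (s ^+ 8)%:E).
  by apply/measurable_EFinP; exact: measurable_funX.
have mp : measurable_fun [set: R] (fun s : R => `|s - m| `^ (- 2^-1)).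
  apply: (@measurableT_comp _ _ _ _ _ _ (fun x : R => x `^ (- 2^-1))).
    exact: measurable_powR.
  by apply: measurableT_comp; [exact: normr_measurable|exact: measurable_funB].
rewrite ge0_integral_normal_prob//; last 2 first.
- by move=> s; rewrite lee_fin mulr_ge0 ?powR_ge0// exprn_even_ge0.
- by apply/measurable_EFinP; apply: measurable_funM => //; exact: measurable_funX.
pose D (s : R) := s ^+ 8 * normal_pdf 0 (Num.sqrt h) s.
rewrite [leLHS](_ : _ = \int[lebesgue_measure]_s
    ((`|s - m| `^ (- 2^-1))%R%:E * (D s)%:E))%E; last first.
  apply: eq_integral => s _; rewrite -!EFinM; congr EFin.
  by rewrite /D mulrAC mulrC.
apply: (le_trans (integral_inv_sqrt_le (c := 384 * h ^+ 4 / Num.sqrt h) m _ _)).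
- by apply: measurable_funM; [exact: measurable_funX|exact: measurable_normal_pdf].
- move=> s; rewrite normal_pdf_power8_le// andbT mulr_ge0 ?normal_pdf_ge0//.
  by rewrite exprn_even_ge0.
have -> : (\int[lebesgue_measure]_s (D s)%:E = \int[normal_prob 0 (Num.sqrt h)]_s (s ^+ 8)%:E)%E.
  rewrite ge0_integral_normal_prob//.
  by move=> s; rewrite lee_fin exprn_even_ge0.
apply: (@le_trans _ _ (12288 * h ^+ 4 + 4 * (384 * h ^+ 4 / Num.sqrt h))%:E).
  rewrite EFinD leeD2r//; have := gaussian_even_moment_le h0 3 => /le_trans; apply.
  by rewrite lee_fin exprMn (_ : 4`! = 24)//; lra.
rewrite lee_fin.
set r := Num.sqrt h in sh0 *.
have hr : h = r ^+ 2 by rewrite sqr_sqrtr// ltW.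
have r1 : r <= 1.
  by rewrite -ler_sqr ?nnegrE ?(ltW sh0)// -hr expr1n.
rewrite hr (_ : 384 * (r ^+ 2) ^+ 4 / r = 384 * r ^+ 7); last by field; rewrite gt_eqF.
rewrite -exprM -exprSr.
have : r ^+ 7 <= r ^+ 3 by rewrite ler_wiXn2l// ltW.
have : r ^+ 8 <= r ^+ 3 by rewrite ler_wiXn2l// ltW.
lra.
Qed.

(** If [|q| < 1/2] then [u |s| >= 1/4], because [v s^2 >= 0]: the point [s] is far
    from [0], which gives the factor [s^8], and with [u^2 <= 4 v] this also
    bounds [1 / v] by a power of [s]. Completing the square,
    [q = v ((s + b)^2 - e)], and [|q| >= v (s - m)^2] for one of the two
    roots [m], or for [m = - b] when there is no real root. *)
Lemma milstein_factor_singular (K h u v : R) : 1 <= K -> 0 < h -> 0 <= u <= K ->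
  0 < v -> u ^+ 2 <= 4 * v -> v * h <= 4^-1 ->
  exists m1 m2 : R, forall s, s != m1 -> s != m2 ->
    singular_part `|milstein_factor h u v s| <=
      2 * (4 * K) ^+ 8 * (s ^+ 8 * `|s - m1| `^ (- 2^-1) + s ^+ 8 * `|s - m2| `^ (- 2^-1)).
Proof.
move=> K1 h0 /andP[u0 uK] v0 uv vh.
pose b := u / (2 * v); pose e := b ^+ 2 - (1 - v * h) / v.
(* The square root of a negative number is 0: without a real root, both m1
   and m2 are the vertex - b. *)
pose r := Num.sqrt e.
exists (- b + r), (- b - r) => s sm1 sm2.
set m1 := - b + r in sm1 *; set m2 := - b - r in sm2 *.
have s8 : 0 <= s ^+ 8 by rewrite exprn_even_ge0.
have K0 : 0 < K by lra.
have rhs0 m : 0 <= s ^+ 8 * `|s - m| `^ (- 2^-1) by rewrite mulr_ge0// powR_ge0.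
have K8 : 0 <= 2 * (4 * K) ^+ 8 by rewrite mulr_ge0// exprn_even_ge0.
rewrite /singular_part; case: ifPn => [q2|_]; last by rewrite mulr_ge0// addr_ge0.
set q := milstein_factor h u v s in q2 *.
have qE : q = v * ((s + b) ^+ 2 - e).
  by rewrite /q /milstein_factor /e /b; field; rewrite gt_eqF.
have dle m : s != m -> v * `|s - m| ^+ 2 <= `|q| ->
    `|q| `^ (- 4^-1) <= 2 * (4 * K) ^+ 8 * (s ^+ 8 * `|s - m| `^ (- 2^-1)).
  move=> sm H.
  have d0 : 0 < `|s - m| by rewrite normr_gt0 subr_eq0.
  set d := `|s - m| in d0 H *.
  have q0 : 0 < `|q| by rewrite (lt_le_trans _ H)// mulr_gt0// exprn_gt0.
  have us : 4^-1 <= u * `|s|.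
    have h1 : q < 2^-1 by rewrite (le_lt_trans (ler_norm _)).
    have h2 : 0 <= v * s ^+ 2 by rewrite mulr_ge0 ?sqr_ge0// ltW.
    have h3 : u * s <= - 4^-1.
      move: h1; rewrite /q /milstein_factor; lra.
    have : `|u * s| = u * `|s| by rewrite normrM ger0_norm.
    by move=> <-; rewrite ler_normr; apply/orP; right; lra.
  have z1 : 1 <= 4 * K * `|s|.
    have : u * `|s| <= K * `|s| by rewrite ler_wpM2r.
    by lra.
  set z := 4 * K * `|s| in z1.
  have vz : v^-1 <= (2 * z) ^+ 4.
    have e1 : 1 <= 64 * v * s ^+ 2.
      have : u ^+ 2 * s ^+ 2 <= 4 * v * s ^+ 2 by rewrite ler_wpM2r// sqr_ge0.
      have : 4^-1 ^+ 2 <= (u * `|s|) ^+ 2 by rewrite lerXn2r ?nnegrE ?mulr_ge0.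
      rewrite exprMn real_normK ?num_real//; lra.
    have e2 : v^-1 <= 64 * s ^+ 2.
      by rewrite -[leLHS]mul1r ler_pdivrMr// mulrAC.
    apply: (le_trans e2).
    have -> : s ^+ 2 = `|s| ^+ 2 by rewrite real_normK ?num_real.
    have e3 : 16 * `|s| ^+ 2 <= z ^+ 2.
      rewrite /z !exprMn; have : 1 <= K ^+ 2 by rewrite exprn_ege1.
      have : 0 <= `|s| ^+ 2 by rewrite sqr_ge0.
      by move: (`|s| ^+ 2) (K ^+ 2) => A B A0 B1; nra.
    have e4 : z ^+ 2 <= z ^+ 4 by rewrite ler_weXn2l.
    have e5 : 0 <= z ^+ 4 by rewrite exprn_even_ge0.
    by rewrite exprMn (_ : 2 ^+ 4 = 16); [lra|ring].
  rewrite powRN.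
  have -> : (`|q| `^ 4^-1)^-1 = (`|q|^-1) `^ 4^-1.
    by rewrite -powRN -(powR_inv1 (normr_ge0 q)) -powRrM mulN1r.
  have lq : `|q|^-1 <= (2 * z) ^+ 4 * (d^-1 ^+ 2).
    have : `|q|^-1 <= (v * d ^+ 2)^-1.
      by rewrite lef_pV2 ?posrE// mulr_gt0// exprn_gt0.
    move=> /le_trans; apply; rewrite invfM -exprVn ler_wpM2r// sqr_ge0//.
  have z0 : 0 <= 2 * z by lra.
  apply: (@le_trans _ _ (((2 * z) ^+ 4 * (d^-1 ^+ 2)) `^ 4^-1)).
    apply: ge0_ler_powR; rewrite ?nnegrE ?invr_ge0//.
    by rewrite mulr_ge0 ?exprn_ge0 ?invr_ge0// ltW.
  rewrite powRM ?exprn_ge0 ?invr_ge0 ?(ltW d0)//.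
  have p1 : ((2 * z) ^+ 4) `^ 4^-1 = 2 * z.
    by rewrite -powR_mulrn// -powRrM divff// powRr1.
  have p2 : (d^-1 ^+ 2) `^ 4^-1 = d `^ (- 2^-1).
    rewrite -powR_mulrn ?invr_ge0 ?(ltW d0)// -(powR_inv1 (ltW d0)) -!powRrM.
    by congr (_ `^ _); field.
  rewrite p1 p2 mulrA ler_wpM2r ?powR_ge0//.
  have : z <= z ^+ 8 by rewrite -[leLHS]expr1 ler_weXn2l.
  have -> : z ^+ 8 = (4 * K) ^+ 8 * s ^+ 8.
    by rewrite /z exprMn; congr (_ * _); rewrite -normrX ger0_norm.
  lra.
suff [H|H] : v * `|s - m1| ^+ 2 <= `|q| \/ v * `|s - m2| ^+ 2 <= `|q|.
- by rewrite mulrDr (le_trans (dle _ sm1 H))// lerDl mulr_ge0.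
- by rewrite mulrDr (le_trans (dle _ sm2 H))// lerDr mulr_ge0.
rewrite qE normrM gtr0_norm//.
rewrite !(ler_pM2l v0) !real_normK ?num_real//.
have -> : s - m1 = s + b - r by rewrite /m1; ring.
have -> : s - m2 = s + b + r by rewrite /m2; ring.
set t := s + b.
have r0 : 0 <= r by exact: sqrtr_ge0.
have [e0|e0] := ltP e 0.
  left; rewrite /r ler0_sqrtr ?(ltW e0)// subr0 ger0_norm; first by lra.
  by have := sqr_ge0 t; lra.
have -> : e = r ^+ 2 by rewrite sqr_sqrtr.
rewrite subr_sqr normrM.
have [t0|t0] := leP 0 t.
  left; rewrite -real_normK ?num_real// expr2 ler_wpM2l//.
  by rewrite [leRHS](ger0_norm (addr_ge0 t0 r0)) ler_norml; apply/andP; split; lra.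
right; rewrite -real_normK ?num_real// expr2 ler_wpM2r//.
rewrite [leRHS]ler0_norm; last by lra.
by rewrite ler_norml; apply/andP; split; lra.
Qed.
End StepLower.

(** * The mean of a small negative power of the one-step factor *)

Section StepLowerIntegral.
Variable R : realType.

Lemma normal_prob_set2 (sigma m1 m2 : R) :
  normal_prob 0 sigma [set m1; m2] = 0%E.
Proof.
have /null_content_dominatesP := normal_prob_dominates 0 sigma; apply.
  exact: measurableU.
by apply: countable_lebesgue_measure0; exact/finite_set_countable/finite_set2.
Qed.

Lemma measurable_singular_part : measurable_fun [set: R] (@singular_part R).
Proof.
by apply: measurable_fun_ifT => //; exact: measurable_fun_ltr.
Qed.

Lemma measurable_milstein_factor (h u v : R) :
  measurable_fun [set: R] (milstein_factor h u v).
Proof.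
apply: measurable_funD => //; apply: measurable_funD; apply: measurable_funM => //.
by apply: measurable_funB => //; exact: measurable_funX.
Qed.

(** A nonzero quadratic polynomial has at most two zeros. *)
Lemma normal_prob_milstein_factor_eq0 (sigma h u v : R) : 0 < v ->
  normal_prob 0 sigma (milstein_factor h u v @^-1` [set 0]) = 0%E.
Proof.
move=> v0.
pose b := u / (2 * v); pose e := b ^+ 2 - (1 - v * h) / v.
pose r := Num.sqrt e.
apply: (@subset_measure0 _ _ R (normal_prob 0 sigma) _ [set - b + r; - b - r]).
- rewrite -[X in measurable X]setTI; apply: measurable_milstein_factor => //.
- exact: measurableU.
- move=> s /= s0.
  have : milstein_factor h u v s = v * ((s + b) ^+ 2 - e).
    by rewrite /milstein_factor /e /b; field; rewrite gt_eqF.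
  rewrite s0 => /esym/eqP; rewrite mulf_eq0 gt_eqF//= subr_eq0 => /eqP sb.
  have er : e = r ^+ 2 by rewrite sqr_sqrtr// -sb sqr_ge0.
  have /eqP : (s + b) ^+ 2 = r ^+ 2 by rewrite sb.
  rewrite eqf_sqr => /orP[] /eqP H; [left|right].
    by rewrite -H; ring.
  by rewrite -H; ring.
- exact: normal_prob_set2.
Qed.

(** The bound of milstein_factor_singular fails at most at the two points [m1] and
    [m2], where the convention [0^(- 1/2) = 0] is at odds with the true value. *)
Lemma integral_singular_part_le (K h u v : R) : 1 <= K -> 0 < h <= 1 ->
  0 <= u <= K -> 0 < v -> u ^+ 2 <= 4 * v -> v * h <= 4^-1 ->
  (\int[normal_prob 0 (Num.sqrt h)]_s (singular_part `|milstein_factor h u v s|)%:E <=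
    (2 * (4 * K) ^+ 8 * (2 * 13824) * (h * Num.sqrt h))%:E)%E.
Proof.
move=> K1 /andP[h0 h1] hu v0 uv vh.
have h01 : 0 < h <= 1 by rewrite h0.
have [m1 [m2 H]] := milstein_factor_singular K1 h0 hu v0 uv vh.
set c := 2 * (4 * K) ^+ 8 in H *.
have c0 : 0 <= c by rewrite mulr_ge0// exprn_even_ge0.
pose g m (s : R) : \bar R := (s ^+ 8 * `|s - m| `^ (- 2^-1))%:E.
have g0 m s : (0 <= g m s)%E.
  by rewrite lee_fin mulr_ge0 ?powR_ge0// exprn_even_ge0.
have mg m : measurable_fun [set: R] (g m).
  apply/measurable_EFinP; apply: measurable_funM; first exact: measurable_funX.
  apply: (@measurableT_comp _ _ _ _ _ _ (fun x : R => x `^ (- 2^-1))).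
    exact: measurable_powR.
  by apply: measurableT_comp; [exact: normr_measurable|exact: measurable_funB].
have mgs : measurable_fun [set: R] (fun s => g m1 s + g m2 s)%E.
  by apply: emeasurable_funD; exact: mg.
apply: (@le_trans _ _ (\int[normal_prob 0 (Num.sqrt h)]_s (c%:E * (g m1 s + g m2 s))))%E.
  apply: ae_ge0_le_integral => //.
  - move=> s _; rewrite lee_fin /singular_part; case: ifP => // _; exact: powR_ge0.
  - apply/measurable_EFinP; apply: (measurableT_comp measurable_singular_part).
    by apply: measurableT_comp; [exact: normr_measurable|exact: measurable_milstein_factor].
  - by move=> s _; apply: mule_ge0; [rewrite lee_fin|exact: adde_ge0].
  - exact: emeasurable_funM.
  - exists [set m1; m2]; split; first exact: measurableU.
      exact: normal_prob_set2.
    move=> s /= ns; apply: contrapT => nm; apply: ns => _.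
    rewrite -EFinD -EFinM lee_fin; apply: H.
      by apply/eqP => sm; apply: nm; left.
    by apply/eqP => sm; apply: nm; right.
rewrite ge0_integralZl//; last by move=> s _; exact: adde_ge0.
have -> : c * (2 * 13824) * (h * Num.sqrt h) =
    c * (13824 * (h * Num.sqrt h) + 13824 * (h * Num.sqrt h)).
  by move: (h * Num.sqrt h) => z; ring.
rewrite [leRHS]EFinM lee_wpmul2l ?lee_fin//.
rewrite ge0_integralD//.
- by rewrite EFinD; apply: leeD; exact: integral_power8_singular.
- exact: mg.
- exact: mg.
Qed.

(** The first summand collects the Taylor remainders, the second one the singular
    part. *)
Definition lower_const (K : R) : R :=
  12500 * (300 * K ^+ 4) + 8 * (2 * (4 * K) ^+ 8 * (2 * 13824)).

Lemma lower_const_ge0 K : 0 <= lower_const K.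
Proof.
have K4 : 0 <= K ^+ 4 by rewrite exprn_even_ge0.
have K8 : 0 <= (4 * K) ^+ 8 by rewrite exprn_even_ge0.
apply: addr_ge0; first exact: mulr_ge0 (ler0n _ _) (mulr_ge0 (ler0n _ _) K4).
apply: mulr_ge0 (ler0n _ _) (mulr_ge0 (mulr_ge0 (ler0n _ _) K8) _).
exact: mulr_ge0 (ler0n _ _) (ler0n _ _).
Qed.

(** Third absolute powers have no exact integral here; the free parameter [r] is to
    be [sqrt h], for which the two terms in [p] balance. *)
Lemma cube_norm_le (p B r : R) : 0 < r ->
  `|p + B| ^+ 3 + `|- p + B| ^+ 3 <=
    8 * (p ^+ 2 * r + p ^+ 4 / r + B ^+ 2 + B ^+ 4).
Proof.
move=> r0.
have B0 := normr_ge0 B; have p0 := normr_ge0 p.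
have e2 (x : R) : x ^+ 2 = `|x| ^+ 2 by rewrite real_normK ?num_real.
have e4 (x : R) : x ^+ 4 = `|x| ^+ 4 by rewrite (exprM _ 2 2) (e2 x) -exprM.
have h1 : `|p + B| ^+ 3 <= (`|p| + `|B|) ^+ 3.
  by rewrite lerXn2r ?nnegrE ?addr_ge0// ler_normD.
have h2 : `|- p + B| ^+ 3 <= (`|p| + `|B|) ^+ 3.
  by rewrite lerXn2r ?nnegrE ?addr_ge0// (le_trans (ler_normD _ _))// normrN.
rewrite (e2 p) (e4 p) (e2 B) (e4 B).
move: h1 h2 B0 p0; move: `|p| `|B| (`|p + B| ^+ 3) (`|- p + B| ^+ 3) => a b A A'.
move=> h1 h2 b0 a0.
have h3 : (a + b) ^+ 3 <= 4 * (a ^+ 3 + b ^+ 3).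
  have : 0 <= (a + b) * (a - b) ^+ 2 by rewrite mulr_ge0 ?addr_ge0// sqr_ge0.
  by lra.
have h4 : a ^+ 3 <= a ^+ 2 * r + a ^+ 4 / r.
  rewrite -subr_ge0 (_ : _ - _ = a ^+ 2 * ((r - a) ^+ 2 + a * r) / r).
    by rewrite divr_ge0 ?(ltW r0)// mulr_ge0 ?sqr_ge0// addr_ge0 ?sqr_ge0// mulr_ge0// ltW.
  by field; rewrite gt_eqF.
have h5 : b ^+ 3 <= b ^+ 2 + b ^+ 4.
  have : 0 <= b ^+ 2 * (1 - b) ^+ 2 by rewrite mulr_ge0// sqr_ge0.
  have : 0 <= b ^+ 3 by rewrite exprn_ge0.
  by lra.
lra.
Qed.

(** The Taylor part is treated as in milstein_step_upper, but its remainder now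
    contains [|s|^3], whose mean is of order [h^(3/2)]: this is the source of the
    square root of [h] in the final lower bound. *)
Lemma milstein_step_lower (K h u v : R) : 1 <= K -> 0 < h <= 8^-1 ->
  0 <= u <= K -> 0 < v <= K -> u ^+ 2 <= 4 * v -> v * h <= 4^-1 ->
  (\int[normal_prob 0 (Num.sqrt h)]_s (`|milstein_factor h u v s| `^ (- h))%:E <=
   (expR (h * (u ^+ 2 * h / 2 + lower_const K * (h * Num.sqrt h))))%:E)%E.
Proof.
move=> K1 /andP[h0 h1] hu /andP[v0 vK] uv vh.
have K0 : 0 <= K by lra.
have hle1 : h <= 1 by lra.
have h01 : 0 < h <= 1 by rewrite h0.
have hv : 0 <= v <= K by rewrite (ltW v0).
have K40 : 0 <= K ^+ 4 by rewrite exprn_ge0.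
set r := Num.sqrt h.
have r0 : 0 < r by rewrite sqrtr_gt0.
have rn0 : r != 0 by rewrite gt_eqF.
have hr : h = r ^+ 2 by rewrite sqr_sqrtr// ltW.
have r1 : r <= 1.
  by rewrite -ler_sqr ?nnegrE ?(ltW r0)// -hr expr1n; lra.
have hler : h <= r by rewrite hr expr2 ler_piMl// ltW.
pose C := 300 * K ^+ 4.
have C0 : 0 <= C := mulr_ge0 (ler0n R 300) K40.
pose x s := u * s + v * (s ^+ 2 - h).
pose g s := 1 + h * (- x s + x s ^+ 2 / 2 + 16 * `|x s| ^+ 3) + 8 * h ^+ 2 * x s ^+ 2.
have mx : measurable_fun [set: R] x.
  apply: measurable_funD; apply: measurable_funM => //.
  by apply: measurable_funB => //; exact: measurable_funX.
have mgg : measurable_fun [set: R] g.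
  apply: measurable_funD; last by apply: measurable_funM => //; exact: measurable_funX.
  apply: measurable_funD => //; apply: measurable_funM => //.
  apply: measurable_funD; first apply: measurable_funD.
  - exact: measurableT_comp.
  - by apply: measurable_funM => //; exact: measurable_funX.
  - apply: measurable_funM => //; apply: measurable_funX.
    by apply: measurableT_comp => //; exact: normr_measurable.
have gg0 s : 0 <= g s.
  rewrite /g; have : 0 <= `|x s| ^+ 3 by rewrite exprn_ge0.
  have := sqr_ge0 (x s - 1) => q1 q2.
  have : 0 <= h * (- x s + x s ^+ 2 / 2 + 16 * `|x s| ^+ 3 + 2^-1).
    by apply: mulr_ge0; [exact: ltW|lra].
  have : 0 <= h ^+ 2 * x s ^+ 2 by rewrite mulr_ge0 ?sqr_ge0.
  by lra.
pose S s := singular_part `|milstein_factor h u v s|.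
have S0 s : 0 <= S s.
  by rewrite /S /singular_part; case: ifP => // _; exact: powR_ge0.
have mS : measurable_fun [set: R] (fun s => (S s)%:E).
  apply/measurable_EFinP; apply: (measurableT_comp measurable_singular_part).
  by apply: measurableT_comp; [exact: normr_measurable|exact: measurable_milstein_factor].
apply: (@le_trans _ _ (\int[normal_prob 0 r]_s ((g s)%:E + (8 * h)%:E * (S s)%:E)))%E.
  apply: ge0_le_integral => //.
  - by apply/measurable_EFinP; exact: measurable_milstein_factor_powR.
  - apply: emeasurable_funD; first exact/measurable_EFinP.
    exact: emeasurable_funM.
  - move=> s _; rewrite -EFinM -EFinD lee_fin.
    by apply: powRN_norm1D_le; rewrite h0.
rewrite ge0_integralD//; last 4 first.
- by move=> s _; rewrite lee_fin.
- exact/measurable_EFinP.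
- by move=> s _; rewrite mule_ge0// lee_fin// mulr_ge0// ltW.
- exact: emeasurable_funM.
rewrite ge0_integralZl//; last 2 first.
- by move=> s _; rewrite lee_fin.
- by rewrite lee_fin mulr_ge0// ltW.
have IS := integral_singular_part_le K1 h01 hu v0 uv vh.
have IG := gaussian_even_bound h0 (g := g)
  (al := 1 + h * (v * h + C * h ^+ 2)) (be := h * (- v + u ^+ 2 / 2 + C * r))
  (ga := h * (2 * C / r)) (de := h * C) mgg gg0.
apply: (le_trans (leeD (IG _ _ _) (lee_wpmul2l _ IS))).
- apply: (mulr_ge0 (ltW h0)); apply: divr_ge0 (ltW r0).
  exact: (mulr_ge0 (ler0n R 2) C0).
- exact: (mulr_ge0 (ltW h0) C0).
- move=> s; rewrite /g /x sqrrN.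
  have [p2 p4 B2 B4] := fourth_power_bounds s K1 h01 hu hv.
  set p := u * s in p2 p4 *; rewrite mulrN -/p.
  set B := v * (s ^+ 2 - h) in B2 B4 *.
  have cube := cube_norm_le p B r0.
  have E : u ^+ 2 * s ^+ 2 = p ^+ 2 by rewrite /p exprMn.
  have EB : v * s ^+ 2 = B + v * h by rewrite /B; ring.
  have hp : h * p ^+ 2 <= r * p ^+ 2 by rewrite ler_wpM2r ?sqr_ge0.
  have hB : h * B ^+ 2 <= B ^+ 2 by exact: (ler_piMl (sqr_ge0 B) hle1).
  have p2r : p ^+ 2 * r <= K ^+ 4 * s ^+ 2 * r by exact: (ler_wpM2r (ltW r0) p2).
  have ri0 : 0 <= r^-1 by rewrite invr_ge0 ltW.
  have p4r : p ^+ 4 / r <= K ^+ 4 * s ^+ 4 / r by exact: (ler_wpM2r ri0 p4).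
  have s40 : 0 <= K ^+ 4 * s ^+ 4 by rewrite mulr_ge0// exprn_even_ge0.
  have s4r : K ^+ 4 * s ^+ 4 <= K ^+ 4 * s ^+ 4 / r.
    by rewrite ler_peMr// invf_ge1.
  have s20 : 0 <= K ^+ 4 * s ^+ 2 * r by exact: (mulr_ge0 (mulr_ge0 K40 (sqr_ge0 s)) (ltW r0)).
  have s80 : 0 <= K ^+ 4 * s ^+ 8 by rewrite mulr_ge0// exprn_even_ge0.
  have KK : 0 <= K ^+ 4 * h ^+ 2 by rewrite mulr_ge0// sqr_ge0.
  have main : (- (p + B) + (p + B) ^+ 2 / 2 + 16 * `|p + B| ^+ 3
       + 8 * h * (p + B) ^+ 2)
     + (- (- p + B) + (- p + B) ^+ 2 / 2 + 16 * `|- p + B| ^+ 3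
       + 8 * h * (- p + B) ^+ 2)
     <= 2 * (- B + p ^+ 2 / 2 + C * (s ^+ 2 * r + 2 * (s ^+ 4 / r) + s ^+ 8 + h ^+ 2)).
    have -> : (- (p + B) + (p + B) ^+ 2 / 2 + 16 * `|p + B| ^+ 3
       + 8 * h * (p + B) ^+ 2)
     + (- (- p + B) + (- p + B) ^+ 2 / 2 + 16 * `|- p + B| ^+ 3
       + 8 * h * (- p + B) ^+ 2) = - 2 * B + p ^+ 2 + B ^+ 2
       + 16 * (`|p + B| ^+ 3 + `|- p + B| ^+ 3)
       + 16 * (h * p ^+ 2) + 16 * (h * B ^+ 2) by field.
    have -> : C * (s ^+ 2 * r + 2 * (s ^+ 4 / r) + s ^+ 8 + h ^+ 2) =
       300 * (K ^+ 4 * s ^+ 2 * r) + 600 * (K ^+ 4 * s ^+ 4 / r)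
       + 300 * (K ^+ 4 * s ^+ 8) + 300 * (K ^+ 4 * h ^+ 2).
      by rewrite /C; ring.
    rewrite -[2 * K ^+ 4 * _]mulrA !mulrDr in B4; rewrite mulrDr in B2.
    rewrite [r * _]mulrC in hp.
    move: cube hp hB p2r p4r s4r s40 s20 s80 KK B2 B4.
    move: (`|p + B| ^+ 3 + `|- p + B| ^+ 3) (h * p ^+ 2) (h * B ^+ 2).
    move: (K ^+ 4 * s ^+ 4 / r) (K ^+ 4 * s ^+ 2 * r) (K ^+ 4 * s ^+ 4) (K ^+ 4 * s ^+ 8) (K ^+ 4 * h ^+ 2).
    move: (p ^+ 2 * r) (p ^+ 4 / r) (B ^+ 4) (B ^+ 2) (p ^+ 2).
    by clear - R => *; lra.
  have := ler_wpM2l (ltW h0) main.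
  have -> : h * (- v + u ^+ 2 / 2 + C * r) * s ^+ 2 = h * (- (B + v * h) + p ^+ 2 / 2 + C * (s ^+ 2 * r)).
    by rewrite -EB -E; ring.
  move=> H; rewrite -subr_ge0 in H; rewrite -subr_ge0; apply: (le_trans H).
  by rewrite le_eqVlt; apply/orP; left; apply/eqP; ring.
- by rewrite lee_fin mulr_ge0// ltW.
rewrite -EFinM -EFinD lee_fin; apply: le_trans (expR_ge1Dx _).
rewrite -/r.
have hhr : h ^+ 2 <= h * r by rewrite expr2 ler_wpM2l// ltW.
have h4r : h ^+ 4 <= h * r.
  rewrite (le_trans _ hhr)// ler_wiXn2l ?(ltW h0)//; lra.
have q1 : h * C * h ^+ 2 <= h * C * (h * r).
  by rewrite ler_wpM2l// mulr_ge0// ltW.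
have q2 : h * C * h ^+ 4 <= h * C * (h * r).
  by rewrite ler_wpM2l// mulr_ge0// ltW.
have q3 : 0 <= h * C * (h * r).
  exact: (mulr_ge0 (mulr_ge0 (ltW h0) C0) (mulr_ge0 (ltW h0) (ltW r0))).
have -> : 64 * (h * (2 * C / r)) * h ^+ 2 = 128 * (h * C * (h * r)).
  by rewrite {2}hr; rewrite hr; field.
rewrite /lower_const -/C.
move: q1 q2 q3; clear - R; move: C r (_ * (2 * 13824)) => C r K2.
lra.
Qed.
End StepLowerIntegral.

(** * Freezing the past *)

Section Freezing.
Context (R : realType) (d : measure_display) (Omega : measurableType d).
Variables (P : probability Omega R) (G : set (set Omega)).
Hypothesis sigG : sigma_algebra [set: Omega] G.
Hypothesis GM : G `<=` measurable.
Local Notation Omega_G := (g_sigma_algebraType G).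

(** The same set of outcomes carries two sigma-algebras, the ambient one and the
    past [G]; the identity is measurable from the former to the latter. *)
Lemma measurable_sub_id : measurable_fun [set: Omega] (id : Omega -> Omega_G).
Proof.
by move=> _ A; rewrite setTI; rewrite /measurable/= sigma_algebra_id// => /GM.
Qed.

Lemma measurable_fun_sub (d' : measure_display) (T' : measurableType d') (f : Omega -> T') :
  measurable_fun [set: Omega_G] (f : Omega_G -> T') -> measurable_fun [set: Omega] f.
Proof. by move=> mf; apply: measurableT_comp mf measurable_sub_id. Qed.

Lemma measurable_fun_subP (d' : measure_display) (T' : measurableType d') (f : Omega -> T') :
  (forall B : set T', measurable B -> G (f @^-1` B)) ->
  measurable_fun [set: Omega_G] (f : Omega_G -> T').
Proof.
by move=> H _ B mB; rewrite setTI /measurable/= sigma_algebra_id//; exact: H.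
Qed.

Context (d2 : measure_display) (T2 : measurableType d2).
Variables (S : Omega -> T2) (N : probability T2 R).
Hypothesis mS : measurable_fun [set: Omega] S.
Hypothesis lawS : forall B : set T2, measurable B -> P (S @^-1` B) = N B.
Hypothesis indS : forall (A : set Omega) (B : set T2), G A -> measurable B ->
  P (A `&` S @^-1` B) = (P A * P (S @^-1` B))%E.

(** Independence says that the joint law of (the outcome seen through [G], [S]) is a
    product measure; the identity is then the theorem of Fubini and Tonelli.
    It replaces the conditional expectation given [G]. *)
Lemma integral_freezing (phi : Omega_G * T2 -> \bar R) :
  measurable_fun [set: Omega_G * T2] phi -> (forall z, (0 <= phi z)%E) ->
  (\int[P]_w phi (w, S w) = \int[P]_w \int[N]_s phi (w, s))%E.
Proof.
move=> mphi phi0.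
pose I : {mfun Omega >-> Omega_G} :=
  HB.pack (id : Omega -> Omega_G) (isMeasurableFun.Build _ _ _ _ _ measurable_sub_id).
have mT : measurable_fun [set: Omega] (fun w => (w : Omega_G, S w)).
  by apply: measurable_fun_pair => //; exact: measurable_sub_id.
pose T : {mfun Omega >-> (Omega_G * T2)%type} :=
  HB.pack (fun w => (w : Omega_G, S w)) (isMeasurableFun.Build _ _ _ _ _ mT).
have mF := measurable_fun_fubini_tonelli_F (m2 := N) phi mphi phi0.
transitivity (\int[distribution P T]_z phi z)%E.
  by rewrite ge0_integral_distribution.
transitivity (\int[distribution P I \x N]_z phi z)%E.
  apply: eq_measure_integral => X mX _.
  apply/esym; apply: product_measure_unique => // A B mA mB.
  rewrite /= /distribution /pushforward/= -lawS//.
  have GA : G A by move: mA; rewrite /measurable/= sigma_algebra_id.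
  rewrite -indS//; congr (P _).
rewrite fubini_tonelli1// ge0_integral_distribution//.
by move=> w; exact: integral_ge0.
Qed.
End Freezing.

(** * Almost sure growth, and measurability of derivatives *)

Section Growth.
Context (R : realType) (d : measure_display) (Omega : measurableType d).
Variable P : probability Omega R.

Lemma sum_expRN_le (K de : R) n : 0 <= K -> 0 < de ->
  \sum_(0 <= i < n) K * expR (- (de * i%:R)) <= K / (1 - expR (- de)).
Proof.
move=> K0 de0; set q := expR (- de).
have q1 : 0 < 1 - q by rewrite subr_gt0 expR_lt1 oppr_lt0.
rewrite -mulr_sumr ler_wpM2l// -[leRHS]mul1r ler_pdivlMr//.
suff -> : (\sum_(0 <= i < n) expR (- (de * i%:R))) * (1 - q) = 1 - q ^+ n.
  by rewrite gerBl exprn_ge0// expR_ge0.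
rewrite mulr_suml; elim: n => [|n IH]; first by rewrite big_geq// expr0 subrr.
rewrite big_nat_recr//= IH -mulNr expRM_natr -/q exprSr; ring.
Qed.

(** The series of the [M n] weighted by [expR (- (b n + de * n))] has finite mean, so
    it converges almost surely, and its terms are bounded by its sum. *)
Lemma ae_growth_bound (M : nat -> Omega -> R) (b : nat -> R) (K de : R) :
  0 <= K -> 0 < de ->
  (forall n, measurable_fun [set: Omega] (M n)) ->
  (forall n w, 0 <= M n w) ->
  (forall n, \int[P]_w (M n w)%:E <= (K * expR (b n))%:E)%E ->
  {ae P, forall w, exists B : R, 0 < B /\ forall n, M n w <= B * expR (b n + de * n%:R)}.
Proof.
move=> K0 de0 mM M0 HM.
pose g n w : \bar R := ((expR (- (b n + de * n%:R)))%:E * (M n w)%:E)%E.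
have g0 n w : (0 <= g n w)%E by rewrite mule_ge0// lee_fin ?expR_ge0.
have mME n : measurable_fun [set: Omega] (fun w => (M n w)%:E) by exact/measurable_EFinP.
have mg n : measurable_fun [set: Omega] (g n) by exact: emeasurable_funM.
pose s w := (\sum_(0 <= n <oo) g n w)%E.
have s0 w : (0 <= s w)%E by exact: nneseries_ge0.
have ms : measurable_fun [set: Omega] s.
  by apply: ge0_emeasurable_sum => //.
have Is : (\int[P]_w s w < +oo)%E.
  rewrite integral_nneseries//.
  apply: (@le_lt_trans _ _ (K / (1 - expR (- de)))%:E); last by rewrite ltry.
  apply: lime_le.
    by apply: is_cvg_nneseries => n _ _; exact: integral_ge0.
  apply: nearW => n.
  apply: (@le_trans _ _ (\sum_(0 <= i < n) K * expR (- (de * i%:R)))%:E); last first.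
    by rewrite lee_fin sum_expRN_le.
  rewrite -sumEFin; apply: lee_sum => i _.
  rewrite ge0_integralZl//; last by move=> w _; rewrite lee_fin.
  apply: (@le_trans _ _ ((expR (- (b i + de * i%:R)))%:E * (K * expR (b i))%:E))%E.
    by rewrite lee_wpmul2l// lee_fin expR_ge0.
  by rewrite -EFinM lee_fin mulrCA -expRD opprD addrAC addNr add0r.
have iS : P.-integrable [set: Omega] s.
  apply/integrableP; split => //.
  by under eq_integral do rewrite gee0_abs//.
have := integrable_ae measurableT iS.
apply: filterS => w /(_ Logic.I) sfin.
have [S SE] : exists S : R, s w = S%:E.
  by exists (fine (s w)); rewrite fineK.
have S0 : 0 <= S by rewrite -lee_fin -SE.
exists (S + 1); split; first by lra.
move=> n; have : (g n w <= s w)%E.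
  apply: (@le_trans _ _ (\sum_(0 <= i < n.+1) g i w)%E).
    by rewrite big_nat_recr//= leeDr// sume_ge0.
  by apply: nneseries_lim_ge => i _ _.
rewrite SE /g -EFinM lee_fin expRN mulrC ler_pdivrMr ?expR_gt0// => /le_trans; apply.
by rewrite ler_wpM2r ?expR_ge0//; lra.
Qed.

(** A derivative is the pointwise limit of difference quotients. *)
Lemma measurable_derive1 (f : R -> R) : (forall x, derivable f x 1) ->
  measurable_fun [set: R] (derive1 f).
Proof.
move=> df.
have cf : continuous f.
  by move=> x; apply: differentiable_continuous; exact/derivable1_diffP.
have mf : measurable_fun [set: R] f by exact: continuous_measurable_fun.
apply: (@measurable_fun_cvg _ R R setT (fun n x => n.+1%:R * (f (n.+1%:R^-1 + x) - f x)) (derive1 f : R -> R)).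
  move=> n; apply: measurable_funM => //; apply: measurable_funB => //.
  by apply: measurableT_comp => //; exact: measurable_funD.
move=> x _.
have H : h^-1 *: (f (h + x) - f x) @[h --> 0^'] --> derive1 f x.
  have : cvg (h^-1 *: (f (h + x) - f x) @[h --> 0^']).
    have := df x; rewrite /derivable.
    by under eq_fun do rewrite /= /GRing.scale/= mulr1.
  exact.
have H2 := cvg_dnbhs_at_right H.
have H3 := (cvg_at_rightP _ _ _).1 H2 (@harmonic R).
under eq_cvg => n do rewrite -[n.+1%:R in X in X * _]invrK.
apply: H3.
by split; [move=> n; rewrite invr_gt0|exact: cvg_harmonic].
Qed.

(** Division by zero gives zero on both sides of [x^-1 = x |x|^(- 2)]. *)
Lemma measurable_inv : measurable_fun [set: R] (fun x : R => x^-1).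
Proof.
rewrite (_ : (fun x => _) = (fun x : R => x * `|x| `^ (- 2%:R))); last first.
  apply/funext => x; have [->|x0] := eqVneq x 0; first by rewrite invr0 mul0r.
  rewrite powRN powR_mulrn// real_normK ?num_real//; field.
  by rewrite x0.
apply: measurable_funM => //.
apply: (@measurableT_comp _ _ _ _ _ _ (fun x : R => x `^ (- 2%:R))).
  exact: measurable_powR.
exact: normr_measurable.
Qed.
End Growth.

(** * Moments of the Milstein approximation *)

Section MilsteinChain.
Context (R : realType) (d : measure_display) (Omega : measurableType d).
Variables (P : probability Omega R) (F : R -> set (set Omega)) (W : R -> Omega -> R).
Hypothesis hF : is_filtration F.
Hypothesis hW : is_brownian_motion P F W.
Variables (a : R -> R) (f : R -> R -> R) (x0 h : R).
Hypothesis hf : forall t x : R, derivable (f t) x 1.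
Hypothesis h_gt0 : 0 < h.
Hypothesis c_gt0 : forall k, 0 < 1 + dA a h k.

Local Notation X := (milstein a f W x0 h).
Local Notation c := (fun k => 1 + dA a h k).
Local Notation Om n := (g_sigma_algebraType (F (grid h n))).

(** The coefficient [u] of the one-step factor, as a function of the current value. *)
Definition diffusion_ratio (k : nat) (x : R) : R := f (grid h k) x / x / c k.

(** The coefficient [v] of the one-step factor, as a function of the current value. *)
Definition milstein_ratio (k : nat) (x : R) : R :=
  2^-1 * (f (grid h k) x * partial_x f (grid h k) x / x) / c k.

Local Notation u := diffusion_ratio.
Local Notation v := milstein_ratio.

Lemma grid_ge0 n : 0 <= grid h n.
Proof. by rewrite mulr_ge0// ltW. Qed.

Lemma gridS n : grid h n.+1 - grid h n = h.
Proof. by rewrite /grid -mulrBl -natrB// subSnn mul1r. Qed.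

Lemma grid_lt n : grid h n < grid h n.+1.
Proof. by rewrite -subr_gt0 gridS. Qed.

Lemma milsteinS n w : X n.+1 w =
  X n w * (c n * milstein_factor h (u n (X n w)) (v n (X n w)) (dW W h n w)).
Proof.
rewrite /=; congr (_ * _).
rewrite /milstein_factor /diffusion_ratio /milstein_ratio.
have cn := c_gt0 n; move: (1 + dA a h n) cn => cc cc0.
move: (milstein a f W x0 h n w) => x.
move: (f _ x) (partial_x _ _ x) (x^-1) (dW _ _ _ _) => y y' xi s.
by field; rewrite gt_eqF.
Qed.

Lemma filtration_sigma n : sigma_algebra [set: Omega] (F (grid h n)).
Proof. by case: hF => H _ _; exact: H (grid_ge0 n). Qed.

Lemma filtration_sub n : F (grid h n) `<=` measurable.
Proof. by case: hF => _ H _; exact: H (grid_ge0 n). Qed.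

Lemma filtrationS n : F (grid h n) `<=` F (grid h n.+1).
Proof. by case: hF => _ _ H; apply: H; [exact: grid_ge0|exact/ltW/grid_lt]. Qed.

Lemma measurable_fun_filtrationS n (g : Omega -> R) :
  measurable_fun [set: Om n] (g : Om n -> R) -> measurable_fun [set: Om n.+1] (g : Om n.+1 -> R).
Proof.
move=> mg; apply: measurable_fun_subP => [|B mB]; first exact: filtration_sigma.
apply: filtrationS.
have := mg measurableT B mB; rewrite setTI /measurable/= sigma_algebra_id//.
exact: filtration_sigma.
Qed.

Lemma measurable_brownian n : measurable_fun [set: Om n] (W (grid h n) : Om n -> R).
Proof.
apply: measurable_fun_subP => [|B mB]; first exact: filtration_sigma.
by case: hW => H _ _ _ _; exact: H (grid_ge0 n) _ mB.
Qed.

Lemma measurable_diffusion_ratio k : measurable_fun [set: R] (u k).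
Proof.
have mfk : measurable_fun [set: R] (f (grid h k)).
  apply: continuous_measurable_fun => x.
  by apply: differentiable_continuous; exact/derivable1_diffP.
apply: measurable_funM => //; apply: measurable_funM => //; exact: measurable_inv.
Qed.

Lemma measurable_milstein_ratio k : measurable_fun [set: R] (v k).
Proof.
have mfk : measurable_fun [set: R] (f (grid h k)).
  apply: continuous_measurable_fun => x.
  by apply: differentiable_continuous; exact/derivable1_diffP.
apply: measurable_funM => //; apply: measurable_funM => //.
apply: measurable_funM; last exact: measurable_inv.
apply: measurable_funM => //; apply: measurable_derive1; exact: hf.
Qed.

Lemma measurable_milstein n : measurable_fun [set: Om n] (X n : Om n -> R).
Proof.
elim: n => [|n IH]; first exact: measurable_cst.
have mX := measurable_fun_filtrationS IH.
rewrite (_ : X n.+1 = fun w => X n w * (c n * milstein_factor h (u n (X n w)) (v n (X n w)) (dW W h n w))); last first.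
  by apply/funext => w; exact: milsteinS.
have mdW : measurable_fun [set: Om n.+1] (dW W h n : Om n.+1 -> R).
  apply: measurable_funB; first exact: measurable_brownian.
  exact: (measurable_fun_filtrationS (@measurable_brownian n)).
have mu : measurable_fun [set: Om n.+1] ((fun w => u n (X n w)) : Om n.+1 -> R).
  exact: (measurableT_comp (@measurable_diffusion_ratio n) mX).
have mv : measurable_fun [set: Om n.+1] ((fun w => v n (X n w)) : Om n.+1 -> R).
  exact: (measurableT_comp (@measurable_milstein_ratio n) mX).
apply: measurable_funM => //; apply: measurable_funM => //.
apply: measurable_funD => //; apply: measurable_funD; apply: measurable_funM => //.
by apply: measurable_funB => //; exact: measurable_funX.
Qed.

Lemma measurable_milsteinT n : measurable_fun [set: Omega] (X n).
Proof.
exact: (measurable_fun_sub (filtration_sigma n) (@filtration_sub n) (@measurable_milstein n)).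
Qed.

Local Notation N := (normal_prob 0 (Num.sqrt h)).

Lemma integral_milstein_freezing n (phi : R -> R -> \bar R) :
  measurable_fun [set: R * measurableTypeR R] (fun z => phi z.1 z.2) ->
  (forall x s, (0 <= phi x s)%E) ->
  (\int[P]_w phi (X n w) (dW W h n w) = \int[P]_w \int[N]_s phi (X n w) s)%E.
Proof.
move=> mphi phi0.
have [Wad W0 Wc Wlaw Wind] := hW.
have mW : measurable_fun [set: Omega] (dW W h n : Omega -> measurableTypeR R).
  apply: (@measurable_funB _ Omega R).
    apply: (measurable_fun_sub (filtration_sigma n.+1) (@filtration_sub n.+1)).
    exact: measurable_brownian.
  apply: (measurable_fun_sub (filtration_sigma n) (@filtration_sub n)).
  exact: measurable_brownian.
have H := @integral_freezing R d Omega P (F (grid h n)) (filtration_sigma n) (@filtration_sub n)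
  _ (measurableTypeR R) (dW W h n) N mW.
have H1 (B : set R) : measurable B -> P (dW W h n @^-1` B) = N B.
  by move=> mB; have := Wlaw _ _ (grid_ge0 n) (grid_lt n) B mB; rewrite gridS.
have H2 (A : set Omega) (B : set R) : F (grid h n) A -> measurable B ->
  P (A `&` dW W h n @^-1` B) = (P A * P (dW W h n @^-1` B))%E.
  by move=> FA mB; exact: (Wind _ _ (grid_ge0 n) (grid_lt n) A B FA mB).
rewrite (H H1 H2 (fun z => phi (X n z.1) z.2))//.
have mz : measurable_fun [set: Om n * measurableTypeR R]
    ((fun z => (X n z.1, z.2)) : Om n * measurableTypeR R -> R * measurableTypeR R).
  apply: measurable_fun_pair; last exact: measurable_snd.
  exact: (measurableT_comp (@measurable_milstein n) measurable_fst).
exact: (measurableT_comp mphi mz).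
Qed.

Lemma measurable_milstein_step n : measurable_fun [set: R * measurableTypeR R]
  (fun z => z.1 * (c n * milstein_factor h (u n z.1) (v n z.1) z.2)).
Proof.
have m1 : measurable_fun [set: R * measurableTypeR R] (fun z => z.1) by exact: measurable_fst.
have m2 : measurable_fun [set: R * measurableTypeR R] (fun z => z.2 : R) by exact: measurable_snd.
have mu := measurableT_comp (@measurable_diffusion_ratio n) m1.
have mv := measurableT_comp (@measurable_milstein_ratio n) m1.
apply: measurable_funM => //; apply: measurable_funM => //.
apply: measurable_funD => //; apply: measurable_funD; apply: measurable_funM => //.
by apply: measurable_funB => //; exact: measurable_funX.
Qed.

(** Each step multiplies the mean of [|X|^tau] by at most [c_n^tau expR (ka n)], by
    freezing the past. The value [0] of the approximation causes no trouble for
    negative [tau] either, since [0^tau = 0] by convention. *)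
Lemma milstein_moment_le (tau : R) (ka : nat -> R) : tau != 0 ->
  (forall n x, x != 0 ->
     (\int[N]_s (`|milstein_factor h (u n x) (v n x) s| `^ tau)%:E <= (expR (ka n))%:E)%E) ->
  forall n, (\int[P]_w (`|X n w| `^ tau)%:E <=
     (`|x0| `^ tau * expR (\sum_(0 <= k < n) (tau * ln (c k) + ka k)))%:E)%E.
Proof.
move=> t0 H; elim=> [|n IH].
  rewrite big_geq// expR0 mulr1 /= integral_cst//.
  by have := probability_setT P => /= ->; rewrite mule1.
have mstep := @measurable_milstein_step n.
have E : (\int[P]_w (`|X n.+1 w| `^ tau)%:E = \int[P]_w \int[N]_s
   (`|X n w * (c n * milstein_factor h (u n (X n w)) (v n (X n w)) s)| `^ tau)%:E)%E.
  rewrite -(integral_milstein_freezing n (phi := fun x s =>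
    (`|x * (c n * milstein_factor h (u n x) (v n x) s)| `^ tau)%:E)).
  - by apply: eq_integral => w _; rewrite milsteinS.
  - apply/measurable_EFinP.
    apply: (@measurableT_comp _ _ _ _ _ _ (fun x : R => x `^ tau)).
      exact: measurable_powR.
    by apply: measurableT_comp; [exact: normr_measurable|exact: mstep].
  - by move=> x s; rewrite lee_fin powR_ge0.
rewrite E.
have mXt : measurable_fun [set: Omega] (fun w => (`|X n w| `^ tau)%:E).
  apply/measurable_EFinP.
  apply: (@measurableT_comp _ _ _ _ _ _ (fun x : R => x `^ tau)).
    exact: measurable_powR.
  by apply: measurableT_comp; [exact: normr_measurable|exact: measurable_milsteinT].
have cn0 := c_gt0 n.
pose K := expR (tau * ln (c n) + ka n).
apply: (@le_trans _ _ (\int[P]_w (K%:E * (`|X n w| `^ tau)%:E)))%E; last first.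
  rewrite ge0_integralZl//; last by rewrite lee_fin expR_ge0.
  rewrite big_nat_recr//= expRD -/K mulrA [X in (_ <= X%:E)%E]mulrC EFinM.
  by rewrite lee_wpmul2l// lee_fin expR_ge0.
have mfac x : measurable_fun [set: R] (fun s => (`|milstein_factor h (u n x) (v n x) s| `^ tau)%:E).
  by apply/measurable_EFinP; exact: measurable_milstein_factor_powR.
have inner w : (\int[N]_s
   (`|X n w * (c n * milstein_factor h (u n (X n w)) (v n (X n w)) s)| `^ tau)%:E
   <= K%:E * (`|X n w| `^ tau)%:E)%E.
  move: (X n w) => x.
  have -> : (\int[N]_s (`|x * (c n * milstein_factor h (u n x) (v n x) s)| `^ tau)%:E =
     (`|x| `^ tau * c n `^ tau)%:E * \int[N]_s (`|milstein_factor h (u n x) (v n x) s| `^ tau)%:E)%E.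
    rewrite -ge0_integralZl//; last 2 first.
    - exact: mfac.
    - by rewrite lee_fin mulr_ge0 ?powR_ge0.
    apply: eq_integral => s _; rewrite -EFinM !normrM mulrA (gtr0_norm cn0).
    by rewrite !powRM// ?mulr_ge0// ltW.
  have [xE|x0'] := eqVneq x 0.
    by rewrite xE normr0 powR0// mul0r mul0e mule0.
  apply: (le_trans (lee_wpmul2l _ (H n x x0'))).
    by rewrite lee_fin mulr_ge0 ?powR_ge0.
  have cp : c n `^ tau = expR (tau * ln (c n)) by rewrite /powR gt_eqF.
  by rewrite -!EFinM lee_fin /K expRD cp -mulrA [leRHS]mulrC.
apply: ge0_le_integral => //.
- by move=> w _; apply: integral_ge0 => s _; rewrite lee_fin powR_ge0.
- have := @measurable_fun_fubini_tonelli_F _ _ R (measurableTypeR R) R N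
    (fun z => (`|z.1 * (c n * milstein_factor h (u n z.1) (v n z.1) z.2)| `^ tau)%:E).
  move=> HF; have {}HF := HF _ _.
  apply: (measurableT_comp (HF _ _) (@measurable_milsteinT n)).
  + apply/measurable_EFinP.
    apply: (@measurableT_comp _ _ _ _ _ _ (fun x : R => x `^ tau)).
      exact: measurable_powR.
    by apply: measurableT_comp; [exact: normr_measurable|exact: mstep].
  + by move=> z; rewrite lee_fin powR_ge0.
- exact: emeasurable_funM.
Qed.

(** Given a nonzero past, the next value vanishes only if the increment is a root of
    a nonzero quadratic polynomial. *)
Lemma milstein_neq0 : x0 != 0 -> (forall n x, x != 0 -> 0 < v n x) ->
  {ae P, forall w, forall n, X n w != 0}.
Proof.
move=> x00 v0; apply: ae_foralln => n.
have mz0 n' : measurable (X n' @^-1` [set 0]).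
  by rewrite -[X in measurable X]setTI; apply: measurable_milsteinT.
suff H : P (X n @^-1` [set 0]) = 0%E.
  exists (X n @^-1` [set 0]); split => // w /= /negP; rewrite negbK => /eqP //.
elim: n => [|n IH].
  by rewrite (_ : _ @^-1` _ = set0) ?measure0//; apply/seteqP; split => // w /= /eqP; rewrite (negbTE x00).
pose Z := (fun z : R * measurableTypeR R => z.1 * (c n * milstein_factor h (u n z.1) (v n z.1) z.2)) @^-1` [set 0].
have mZ : measurable Z.
  by rewrite -[X in measurable X]setTI; apply: measurable_milstein_step.
have m1 : measurable_fun [set: R * measurableTypeR R] (fun z => (\1_Z (z.1, z.2))%:E : \bar R).
  apply/measurable_EFinP.
  rewrite (_ : (fun z => _) = \1_Z); last by apply/funext => -[].
  exact: measurable_indic.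
have E := @integral_milstein_freezing n (fun x s => (\1_Z (x, s))%:E) m1.
have -> : P (X n.+1 @^-1` [set 0]) = (\int[P]_w (\1_Z (X n w, dW W h n w))%:E)%E.
  rewrite -[X in P X]setIT -integral_indic//; apply: eq_integral => w _.
  congr EFin; rewrite !indicE; congr (nat_of_bool _)%:R.
  by apply/idP/idP; rewrite !inE /Z /preimage/= -/(milstein _ _ _ _ _ _ _) => <-; rewrite -milsteinS.
rewrite {}E; last by move=> x s; rewrite lee_fin.
rewrite (eq_integral (fun w => (\1_(X n @^-1` [set 0]) w)%:E)).
  by rewrite integral_indic// setIT; exact: IH.
move=> w _; rewrite indicE.
have [xE|xn0] := eqVneq (X n w) 0.
  rewrite mem_set//= (eq_integral (fun=> 1%E)); last first.
    by move=> s _; rewrite xE indicE mem_set// /Z/preimage/= mul0r.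
  by rewrite integral_normal_cst.
rewrite memNset; last by move=> /= /eqP; rewrite (negbTE xn0).
rewrite -[RHS](normal_prob_milstein_factor_eq0 (Num.sqrt h) h (u n (X n w)) (v0 n _ xn0)).
rewrite -[X in _ = normal_prob _ _ X]setIT -integral_indic//; last first.
  by rewrite -[X in measurable X]setTI; apply: measurable_milstein_factor.
apply: eq_integral => s _; congr EFin; rewrite !indicE; congr (nat_of_bool _)%:R.
apply/idP/idP; rewrite !inE /Z /preimage/=.
  by move=> /eqP; rewrite !mulf_eq0 (negbTE xn0) (gt_eqF (c_gt0 n))/= => /eqP.
by move=> ->; rewrite !mulr0.
Qed.
End MilsteinChain.

(** * Growth of the Milstein approximation *)

Section MilsteinGrowth.
Context (R : realType) (d : measure_display) (Omega : measurableType d).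
Variables (P : probability Omega R) (F : R -> set (set Omega)) (W : R -> Omega -> R).
Hypothesis hF : is_filtration F.
Hypothesis hW : is_brownian_motion P F W.
Variables (a : R -> R) (f : R -> R -> R) (x0 h : R).
Hypothesis hf : forall t x : R, derivable (f t) x 1.
Hypothesis x0_neq0 : x0 != 0.
Hypothesis h_gt0 : 0 < h.
Hypothesis c_gt0 : forall k, 0 < 1 + dA a h k.
Hypothesis v_gt0 : forall k x, x != 0 -> 0 < milstein_ratio a f h k x.

Definition mean_logR n : R := n%:R^-1 * \sum_(0 <= k < n) (ln `|1 + dA a h k| / h).
Definition mean_inv_sqR n : R := n%:R^-1 * \sum_(0 <= k < n) ((1 + dA a h k) ^+ 2)^-1.

(** Both estimates of the theorem at once: [sg] is [1] for the upper one and [-1] for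
    the lower one. *)
Lemma milstein_growth (sg ka E : R) : sg != 0 ->
  (forall n x, x != 0 ->
     (\int[normal_prob 0 (Num.sqrt h)]_s
       (`|milstein_factor h (diffusion_ratio a f h n x) (milstein_ratio a f h n x) s| `^ (sg * h))%:E
      <= (expR (h * (ka * h / (1 + dA a h n) ^+ 2 + E * h)))%:E)%E) ->
  {ae P, forall w, exists B : R, forall n, (0 < n)%N ->
    milstein a f W x0 h n w != 0 /\
    sg * (ln `|milstein a f W x0 h n w| / (n%:R * h)) <=
      sg * mean_logR n + ka * mean_inv_sqR n + E + h + B / n%:R}.
Proof.
move=> sg0 H.
have tau0 : sg * h != 0 by rewrite mulf_neq0// gt_eqF.
have HM := milstein_moment_le hF hW x0 hf h_gt0 c_gt0 tau0 H.
pose b n := \sum_(0 <= k < n) (sg * h * ln (1 + dA a h k) +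
  h * (ka * h / (1 + dA a h k) ^+ 2 + E * h)).
have {}HM n : (\int[P]_w (`|milstein a f W x0 h n w| `^ (sg * h))%:E <=
    (`|x0| `^ (sg * h) * expR (b n))%:E)%E by exact: HM.
have bE n : b n = h ^+ 2 * (sg * (\sum_(0 <= k < n) (ln `|1 + dA a h k| / h))
    + ka * (\sum_(0 <= k < n) ((1 + dA a h k) ^+ 2)^-1) + n%:R * E).
  elim: n => [|n IH]; first by rewrite /b !big_geq// mul0r !mulr0 !addr0 mulr0.
  rewrite /b !big_nat_recr//= -/(b n) IH gtr0_norm// -natr1.
  have := c_gt0 n; move: (1 + dA a h n) => c c0.
  by field; rewrite !gt_eqF.
have mM n : measurable_fun [set: Omega] (fun w => `|milstein a f W x0 h n w| `^ (sg * h)).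
  apply: (@measurableT_comp _ _ _ _ _ _ (fun x : R => x `^ (sg * h))).
    exact: measurable_powR.
  apply: measurableT_comp; first exact: normr_measurable.
  exact: (measurable_milsteinT hF hW).
(* After division by n h^2, the growth rate h^3 costs h. *)
have h3 : 0 < h ^+ 3 by rewrite exprn_gt0.
have G := ae_growth_bound (powR_ge0 `|x0| (sg * h)) h3 mM (fun n w => powR_ge0 _ _) HM.
have NZ := milstein_neq0 hF hW hf h_gt0 c_gt0 x0_neq0 v_gt0.
apply: filterS2 G NZ => w [B [B0 HB]] nz.
exists (ln B / h ^+ 2) => n n0; split; first exact: nz.
have n0' : 0 < n%:R :> R by rewrite ltr0n.
have X0 : 0 < `|milstein a f W x0 h n w| by rewrite normr_gt0.
have eB : B = expR (ln B) by rewrite lnK ?posrE.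
have := HB n; rewrite /powR (gt_eqF X0) {1}eB -expRD ler_expR.
rewrite bE /mean_logR /mean_inv_sqR.
move: (\sum_(0 <= k < n) _) (\sum_(0 <= k < n) _) (ln B) (ln _) => SL Sm lB lX.
move: (n%:R : R) n0' => m m0 Hb.
have p : 0 < m * h ^+ 2 by rewrite mulr_gt0// exprn_gt0.
rewrite -(ler_pM2r p).
apply: le_trans (le_trans _ Hb) _; rewrite le_eqVlt; apply/orP; left; apply/eqP.
  by field; rewrite !gt_eqF.
by field; rewrite !gt_eqF.
Qed.
End MilsteinGrowth.

Section LimSupFinal.
Variable R : realType.

Lemma mean_bounded (g : nat -> R) (B : R) n : (forall k, `|g k| <= B) ->
  `|n%:R^-1 * \sum_(0 <= k < n) g k| <= B.
Proof.
move=> H; have B0 : 0 <= B := le_trans (normr_ge0 _) (H 0%N).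
case: n => [|n]; first by rewrite big_geq// mulr0 normr0.
rewrite normrM ger0_norm ?invr_ge0// ler_pdivrMl ?ltr0n//.
apply: (le_trans (ler_norm_sum _ _ _)).
apply: (@le_trans _ _ (\sum_(0 <= k < n.+1) B)); first by apply: ler_sum => k _.
by rewrite sumr_const_nat subn0 mulr_natl.
Qed.

(** Stated for real sequences bounded by [A], so that all the limits are finite and
    can be subtracted. *)
Lemma limn_esup_mean_le (u : nat -> \bar R) (L m : nat -> R) (ka e B A : R) :
  0 <= ka -> (forall n, `|L n| <= A) -> (forall n, `|m n| <= A) ->
  (forall n, (0 < n)%N -> u n <= (L n - ka * m n + e + B / n%:R)%:E)%E ->
  (limn_esup u <= limn_esup (EFin \o L) - ka%:E * limn_einf (EFin \o m) + e%:E)%E.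
Proof.
move=> ka0 LA mA H.
have LA1 n : (((- A)%:E <= (EFin \o L) n) /\ ((EFin \o L) n <= A%:E))%E.
  by have := LA n; rewrite ler_norml /= !lee_fin => /andP[].
have mA1 n : (((- A)%:E <= (EFin \o m) n) /\ ((EFin \o m) n <= A%:E))%E.
  by have := mA n; rewrite ler_norml /= !lee_fin => /andP[].
have fL := limn_esup_fin_num (fun n => (LA1 n).1) (fun n => (LA1 n).2).
have fm := limn_einf_fin_num (fun n => (mA1 n).1) (fun n => (mA1 n).2).
move: fL fm; case EL : (limn_esup (EFin \o L)) => [l| |]// _.
case Em : (limn_einf (EFin \o m)) => [l'| |]// _.
rewrite -EFinM -EFinB -EFinD; apply: limn_esup_le_near => ep ep0.
(* the tolerance is spent once on L, ka times on m and once on B / n *)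
pose de := ep / (2 + ka).
have k2 : 0 < 2 + ka by lra.
have de0 : 0 < de by rewrite divr_gt0.
have N1 : \forall n \near \oo, ((EFin \o L) n < (l + de)%:E)%E.
  by apply: limn_esup_lt_near; rewrite EL lte_fin ltrDl.
have N2 : \forall n \near \oo, ((l' - de)%:E < (EFin \o m) n)%E.
  by apply: limn_einf_gt_near; rewrite Em lte_fin gtrBl.
near=> n.
have n0 : (0 < n)%N by near: n; exact: nbhs_infty_gt.
have n0' : 0 < n%:R :> R by rewrite ltr0n.
apply: (le_trans (H n n0)); rewrite lee_fin.
have h1 : L n < l + de by rewrite -lte_fin; near: n.
have h2 : l' - de < m n by rewrite -lte_fin; near: n.
have h3 : B / n%:R <= de.
  rewrite ler_pdivrMr// mulrC -ler_pdivrMr//.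
  by near: n; exact: nbhs_infty_ger.
have h4 : ka * (l' - de) <= ka * m n by rewrite ler_wpM2l// ltW.
have h5 : ep = de * (2 + ka) by rewrite divfK// gt_eqF.
by rewrite h5; lra.
Unshelve. all: by end_near. Qed.

Lemma limn_einf_mean_ge (u : nat -> \bar R) (L m : nat -> R) (ka e B A : R) :
  0 <= ka -> (forall n, `|L n| <= A) -> (forall n, `|m n| <= A) ->
  (forall n, (0 < n)%N -> (L n - ka * m n - e - B / n%:R)%:E <= u n)%E ->
  (limn_einf (EFin \o L) - ka%:E * limn_esup (EFin \o m) - e%:E <= limn_einf u)%E.
Proof.
move=> ka0 LA mA H.
have LA1 n : (((- A)%:E <= (EFin \o L) n) /\ ((EFin \o L) n <= A%:E))%E.
  by have := LA n; rewrite ler_norml /= !lee_fin => /andP[].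
have mA1 n : (((- A)%:E <= (EFin \o m) n) /\ ((EFin \o m) n <= A%:E))%E.
  by have := mA n; rewrite ler_norml /= !lee_fin => /andP[].
have fL := limn_einf_fin_num (fun n => (LA1 n).1) (fun n => (LA1 n).2).
have fm := limn_esup_fin_num (fun n => (mA1 n).1) (fun n => (mA1 n).2).
have := @limn_esup_mean_le (-%E \o u) (fun n => - L n) (fun n => - m n) ka e B A ka0.
have -> : EFin \o (fun n => - L n) = -%E \o (EFin \o L) by apply/funext.
have -> : EFin \o (fun n => - m n) = -%E \o (EFin \o m) by apply/funext.
rewrite !limn_esupN limn_einfN => K.
have {}K := K _ _ _; move: K.
move: fL fm; case EL : (limn_einf (EFin \o L)) => [l| |]// _.
case Em : (limn_esup (EFin \o m)) => [l'| |]// _.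
rewrite -?EFinN -?EFinM -?EFinN -?EFinB -?EFinD => K.
rewrite leeNl -EFinN in K.
apply: le_trans (K _ _ _).
- by rewrite lee_fin; lra.
- by move=> n; rewrite normrN.
- by move=> n; rewrite normrN.
- move=> n n0 /=; rewrite leeNl -EFinN; apply: le_trans (H n n0).
  by rewrite lee_fin; lra.
Qed.
End LimSupFinal.

(** Here [F] is [f / x], [p] is [x (d_x f) / f] and [c] is [1 + dA]. The inequality
    [u^2 <= 4 v] amounts to [1 <= 2 p c], which holds because
    [2 p c >= 4 (1 + ga) / (3 + 2 ga)] and [ga >= - 1/2]. *)
Lemma milstein_ratio_bounds (R : realType) (F p c ga fl fu M : R) :
  0 < fl -> fl <= F <= fu -> - 2^-1 < ga -> 1 + ga <= c ->
  2 / (3 + 2 * ga) <= p -> p <= M ->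
  let u := F / c in let v := 2^-1 * (F ^+ 2 * p) / c in
  [/\ fl ^+ 2 / c ^+ 2 <= u ^+ 2, u ^+ 2 <= fu ^+ 2 / c ^+ 2,
      0 <= u <= 2 * fu, 0 < v <= fu ^+ 2 * M & u ^+ 2 <= 4 * v].
Proof.
move=> fl0 /andP[flF Ffu] ga0 gac gap pM u v.
have c2 : 2^-1 < c by lra.
have c0 : 0 < c by lra.
have F0 : 0 < F by lra.
have g3 : 0 < 3 + 2 * ga by lra.
have p0 : 0 < p by rewrite (lt_le_trans _ gap)// divr_gt0.
have ci : c^-1 <= 2 by rewrite -[leRHS]invrK lef_pV2 ?posrE//; lra.
have F2 : F ^+ 2 <= fu ^+ 2 by rewrite lerXn2r ?nnegrE//; lra.
have F20 : 0 < F ^+ 2 by rewrite exprn_gt0.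
have ci0 : 0 < c^-1 by rewrite invr_gt0.
split.
- rewrite /u expr_div_n ler_wpM2r ?invr_ge0 ?exprn_ge0 ?(ltW c0)//.
  by rewrite lerXn2r ?nnegrE//; lra.
- by rewrite /u expr_div_n ler_wpM2r ?invr_ge0 ?exprn_ge0 ?(ltW c0).
- rewrite /u divr_ge0 ?(ltW F0) ?(ltW c0)//= mulrC.
  by apply: ler_pM => //; exact: ltW.
- rewrite /v; apply/andP; split; first by rewrite divr_gt0// !mulr_gt0.
  rewrite mulrC mulrA -[leRHS]mul1r; apply: ler_pM.
  + by rewrite mulr_ge0// ltW.
  + by rewrite mulr_ge0// ltW.
  + by lra.
  + by apply: ler_pM => //; exact: ltW.
rewrite /u /v expr_div_n ler_pdivrMr ?exprn_gt0//.
have -> : 4 * (2^-1 * (F ^+ 2 * p) / c) * c ^+ 2 = F ^+ 2 * (2 * (p * c)).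
  by field; rewrite gt_eqF.
rewrite ler_peMr ?(ltW F20)//.
have h1 : 2 <= p * (3 + 2 * ga) by rewrite -ler_pdivrMr.
have h2 : p * (1 + ga) <= p * c by rewrite ler_wpM2l// ltW.
have h3 : 0 <= p * (1 + 2 * ga) by apply: mulr_ge0; lra.
lra.
Qed.

(** * The main estimate *)

Lemma milstein_step_bounds (R : realType) (K : R) : 1 <= K ->
  exists2 C : R, 0 <= C & forall h u v : R, 0 < h <= 8^-1 -> 0 <= u <= K ->
    0 < v <= K -> u ^+ 2 <= 4 * v -> v * h <= 4^-1 ->
  (\int[normal_prob 0 (Num.sqrt h)]_s (`|milstein_factor h u v s| `^ h)%:E <=
     (expR (h * (- (u ^+ 2 * h / 2) + C * h ^+ 2)))%:E)%E /\
  (\int[normal_prob 0 (Num.sqrt h)]_s (`|milstein_factor h u v s| `^ (- h))%:E <=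
     (expR (h * (u ^+ 2 * h / 2 + C * (h * Num.sqrt h))))%:E)%E.
Proof.
move=> K1; have := @milstein_step_lower R K; have := @milstein_step_upper R K.
move: (upper_const K) (lower_const K) (upper_const_ge0 K) (lower_const_ge0 K).
move=> Cu Cl Cu0 Cl0 U L.
exists (Cu + Cl) => [|h u v hh hu hv uv vh]; first exact: addr_ge0.
have /andP[h0 h8] := hh; have /andP[v0 vK] := hv.
have h2 : 0 < h <= 2^-1 by rewrite h0; lra.
have v0K : 0 <= v <= K by rewrite (ltW v0).
split.
  apply: (le_trans (U h u v K1 h2 hu v0K)).
  rewrite lee_fin ler_expR ler_pM2l// lerD2l.
  by rewrite ler_wpM2r ?sqr_ge0// lerDl.
apply: (le_trans (L h u v K1 hh hu hv uv vh)).
rewrite lee_fin ler_expR ler_pM2l// lerD2l.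
by rewrite ler_wpM2r ?lerDr// mulr_ge0 ?sqrtr_ge0// ltW.
Qed.

Theorem theorem1p3 (R : realType) (d : measure_display)
    (Omega : measurableType d) (P : probability Omega R)
    (F : R -> set (set Omega)) (W : R -> Omega -> R)
    (hF : is_filtration F) (hW : is_brownian_motion P F W)
    (x0 : R) (hx0 : x0 != 0)
    (a : R -> R)
    (ha : locally_integrable `]0, +oo[ a)
    (ha0 : (@lebesgue_measure R).-integrable `[0, 1] (EFin \o a))
    (f : R -> R -> R) (hf : forall t x : R, derivable (f t) x 1)
    (h1 : limf_esup
            (fun t : R => (t^-1 * \int[lebesgue_measure]_(s in `[0, t]) a s)%:E)
            +oo%R \is a fin_num)
    (h0 : R) (h0_gt0 : 0 < h0)
    (h2 : forall h : R, 0 < h < h0 ->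
       [/\ has_lbound (range (dA a h)),
           - 2^-1 < gamma_star a h
         & has_ubound (range (dA a h))])
    (fl fu : R) (fl_gt0 : 0 < fl) (fu_gt0 : 0 < fu)
    (h3 : forall t x : R, x != 0 -> fl <= f t x / x <= fu)
    (h3l : forall h : R, 0 < h < h0 -> forall t x : R, x != 0 ->
       Num.max 2^-1 (2 / (3 + 2 * gamma_star a h))
         <= x * partial_x f t x / f t x)
    (h3u : exists M : R, forall t x : R, x != 0 ->
       x * partial_x f t x / f t x <= M) :
  exists hstar : R, 0 < hstar < 1 /\
  exists (C : R) (r1 r2 : R -> R),
    (forall h : R, 0 < h < hstar ->
       `|r1 h| <= C * h /\ `|r2 h| <= C * Num.sqrt h) /\
    (forall h : R, 0 < h < hstar ->
       {ae P, forall w,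
          (limn_esup (milstein_exponent a f W x0 h w)
           <= limn_esup (mean_log a h)
              + (fu ^+ 2 / 2)%:E * limn_esup (mean_inv_sq a h)
              - (fl ^+ 2)%:E * limn_einf (mean_inv_sq a h)
              + (r1 h)%:E)%E} /\
       {ae P, forall w,
          (limn_einf (milstein_exponent a f W x0 h w)
           >= limn_einf (mean_log a h)
              + (fl ^+ 2 / 2)%:E * limn_einf (mean_inv_sq a h)
              - (fu ^+ 2)%:E * limn_esup (mean_inv_sq a h)
              + (r2 h)%:E)%E}).
Proof.
have [M HM] := h3u.
have flfu : fl <= fu.
  by have /andP[] := h3 0 1 (oner_neq0 _) => /le_trans; apply.
(* K bounds both coefficients of the one-step factor: as the inverses of the
   numbers 1 + dA are at most 2, u is at most 2 fu and v at most fu^2 M. *)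
pose K := 1 + 2 * fu + fu ^+ 2 * `|M|.
have fu2 : 0 <= fu ^+ 2 * `|M| by rewrite mulr_ge0 ?sqr_ge0.
have K1 : 1 <= K by rewrite /K; lra.
have K0 : 0 < K by lra.
(* hs <= 1 / (4 K) makes v h <= 1/4, which keeps the one-step factor above
   1/2 as long as u |s| < 1/4. *)
pose hs := Num.min h0 (Num.min 8^-1 (4 * K)^-1).
have hs0 : 0 < hs by rewrite !lt_min h0_gt0 invr_gt0 ltr0n/= invr_gt0 mulr_gt0.
have hs8 : hs <= 8^-1 by rewrite !ge_min lexx orbT.
have hsK : hs <= (4 * K)^-1 by rewrite !ge_min lexx !orbT.
have hsh0 : hs <= h0 by rewrite ge_min lexx.
exists hs; split; first by rewrite hs0; lra.
have [C C0 stepC] := milstein_step_bounds K1.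
have base (h : R) : 0 < h < hs ->
  [/\ (forall k, 2^-1 < 1 + dA a h k),
      (exists A : R, (forall n, `|mean_logR a h n| <= A) /\ (forall n, `|mean_inv_sqR a h n| <= A)) &
      forall k x, x != 0 -> let u := diffusion_ratio a f h k x in let v := milstein_ratio a f h k x in
      [/\ fl ^+ 2 / (1 + dA a h k) ^+ 2 <= u ^+ 2, u ^+ 2 <= fu ^+ 2 / (1 + dA a h k) ^+ 2,
      0 <= u <= K, 0 < v <= K & u ^+ 2 <= 4 * v]].
  move=> /andP[hp hhs].
  have hh0 : 0 < h < h0 by rewrite hp (lt_le_trans hhs).
  have [lb ga ub] := h2 h hh0.
  have dAge k : gamma_star a h <= dA a h k by apply: ge_inf => //; exists k.
  have c2 k : 2^-1 < 1 + dA a h k by have := dAge k; lra.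
  split => //.
  - have [U HU] := ub.
    have cU k : 1 + dA a h k <= 1 + U by rewrite lerD2l; apply: HU; exists k.
    exists ((1 + `|U|) / h + 4); split => n; apply: mean_bounded => k.
    + have c0 : 0 < 1 + dA a h k by have := c2 k; lra.
      rewrite (gtr0_norm c0) normrM normfV (gtr0_norm hp).
      apply: (@le_trans _ _ ((1 + `|U|) / h)); last by rewrite lerDl.
      rewrite ler_wpM2r ?invr_ge0 ?(ltW hp)//.
      have l1 : ln (1 + dA a h k) <= dA a h k by apply: le_ln1Dx; have := c2 k; lra.
      have l2 : - ln (1 + dA a h k) <= 1.
        rewrite -lnV ?posrE// (_ : _^-1 = 1 + ((1 + dA a h k)^-1 - 1)); last by rewrite subrKC.
        have ci : (1 + dA a h k)^-1 <= 2 by rewrite -[leRHS]invrK lef_pV2 ?posrE ?invr_gt0// ltW.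
        have ci0 : 0 < (1 + dA a h k)^-1 by rewrite invr_gt0.
        by apply: (le_trans (le_ln1Dx _)); lra.
      have := cU k; have := ler_norm U; have := normr_ge0 U.
      by rewrite ler_norml => *; apply/andP; split; lra.
    + have c0 : 0 < 1 + dA a h k by have := c2 k; lra.
      rewrite ger0_norm ?invr_ge0 ?sqr_ge0//.
      apply: (@le_trans _ _ 4).
        rewrite -exprVn (_ : 4 = 2 ^+ 2); last by ring.
        rewrite lerXn2r ?nnegrE ?invr_ge0 ?(ltW c0)//.
        by rewrite -[leRHS]invrK lef_pV2 ?posrE ?invr_gt0// ltW.
      by rewrite lerDr divr_ge0 ?addr_ge0// ltW.
  - move=> k x xn0 u v.
    have pl : 2 / (3 + 2 * gamma_star a h) <= x * partial_x f (grid h k) x / f (grid h k) x.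
      by apply: le_trans (h3l h hh0 _ _ xn0); rewrite le_max lexx orbT.
    have cga : 1 + gamma_star a h <= 1 + dA a h k by rewrite lerD2l.
    have := milstein_ratio_bounds fl_gt0 (h3 (grid h k) x xn0) ga cga pl (HM _ _ xn0).
    have /andP[Fl _] := h3 (grid h k) x xn0.
    have fn0 : f (grid h k) x != 0.
      by apply/eqP => fE; move: Fl; rewrite fE mul0r => ?; lra.
    rewrite (_ : 2^-1 * _ / _ = v); last first.
      rewrite /v /milstein_ratio; have := c2 k; move: (1 + dA a h k) => c c2k.
      move: (f _ _) (partial_x _ _ _) fn0 => y y' y0; field.
      by rewrite xn0 y0/= gt_eqF//; lra.
    rewrite -/(diffusion_ratio a f h k x) -/u => -[q1 q2 /andP[q3 q4] /andP[q5 q6] q7].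
    have MM : fu ^+ 2 * M <= fu ^+ 2 * `|M| by rewrite ler_wpM2l ?sqr_ge0// ler_norm.
    by split => //; apply/andP; split => //; rewrite /K; lra.
exists (C + 1), (fun h => (C + 1) * h), (fun h => - ((C + 1) * Num.sqrt h)).
split.
  move=> h /andP[hp hhs].
  have s0 : 0 <= Num.sqrt h by exact: sqrtr_ge0.
  split.
    rewrite ger0_norm; last by apply: mulr_ge0; lra.
    by [].
  by rewrite normrN ger0_norm//; apply: mulr_ge0 => //; lra.
move=> h hh; have [c2 [A [LA mA]] uv] := base h hh.
have /andP[hp hhs] := hh.
have c0 k : 0 < 1 + dA a h k by have := c2 k; lra.
have v0 k x : x != 0 -> 0 < milstein_ratio a f h k x.
  by move=> xn0; have [_ _ _ /andP[]] := uv k x xn0.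
have h8 : 0 < h <= 8^-1 by rewrite hp; lra.
have vh4 v : v <= K -> v * h <= 4^-1.
  move=> vK; apply: (@le_trans _ _ (K * h)); first by rewrite ler_wpM2r// ltW.
  have : h <= (4 * K)^-1 by rewrite (le_trans (ltW hhs)).
  by rewrite -[leRHS]mul1r ler_pdivlMr ?mulr_gt0//; lra.
have hr : h <= Num.sqrt h.
  have r0 : 0 < Num.sqrt h by rewrite sqrtr_gt0.
  have e : h = Num.sqrt h ^+ 2 by rewrite sqr_sqrtr// ltW.
  by rewrite {1}e -[leRHS]expr1 ler_wiXn2l ?(ltW r0)// -ler_sqr ?nnegrE ?(ltW r0)// -e expr1n; lra.
have [M1 [M2 [E1 E2 M21 M20]]] : exists M1 M2 : R,
  [/\ limn_esup (mean_inv_sq a h) = M1%:E, limn_einf (mean_inv_sq a h) = M2%:E,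
      M2 <= M1 & 0 <= M2].
  have mA1 n : (((- A)%:E <= mean_inv_sq a h n) /\ (mean_inv_sq a h n <= A%:E))%E.
    by have := mA n; rewrite ler_norml !lee_fin => /andP[].
  have f1 := limn_esup_fin_num (fun n => (mA1 n).1) (fun n => (mA1 n).2).
  have f2 := limn_einf_fin_num (fun n => (mA1 n).1) (fun n => (mA1 n).2).
  exists (fine (limn_esup (mean_inv_sq a h))), (fine (limn_einf (mean_inv_sq a h))).
  rewrite !fineK//; split => //.
    by rewrite fine_le// limn_einf_sup.
  rewrite fine_ge0//; apply: limn_einf_ge_near => e e0; apply: nearW => n.
  rewrite lee_fin (@le_trans _ _ 0)//; first by lra.
  rewrite mulr_ge0 ?invr_ge0//; apply: sumr_ge0 => k _.
  by rewrite invr_ge0 sqr_ge0.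
have LA1 n : (((- A)%:E <= mean_log a h n) /\ (mean_log a h n <= A%:E))%E.
  by have := LA n; rewrite ler_norml !lee_fin => /andP[].
have fL1 := limn_esup_fin_num (fun n => (LA1 n).1) (fun n => (LA1 n).2).
have fL2 := limn_einf_fin_num (fun n => (LA1 n).1) (fun n => (LA1 n).2).
have fM : fl ^+ 2 * M2 <= fu ^+ 2 * M1.
  by apply: ler_pM => //; rewrite ?sqr_ge0// lerXn2r ?nnegrE ?(ltW fl_gt0) ?(ltW fu_gt0).
have expE w n : (0 < n)%N -> milstein a f W x0 h n w != 0 ->
    milstein_exponent a f W x0 h w n = (ln `|milstein a f W x0 h n w| / (n%:R * h))%:E.
  move=> n0 X0; rewrite /milstein_exponent lne_EFin ?normr_gt0//.
  by rewrite -EFinM mulrC.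
split.
- have G := @milstein_growth R d Omega P F W hF hW a f x0 h hf hx0 hp c0 v0 1
    (- (fl ^+ 2 / 2)) (C * h) (oner_neq0 _).
  apply: filterS (G _) => [w [B HB]|n x xn0].
    rewrite E1 E2.
    apply: le_trans (limn_esup_mean_le (L := mean_logR a h) (m := mean_inv_sqR a h)
      (ka := fl ^+ 2 / 2) (e := (C + 1) * h) (B := B) (A := A) _ LA mA _) _.
    + by rewrite divr_ge0// sqr_ge0.
    + move=> n n0; have [X0 H] := HB n n0.
      by rewrite expE// lee_fin; move: H; rewrite !mul1r; lra.
    + rewrite (_ : EFin \o mean_inv_sqR a h = mean_inv_sq a h)// E2.
      rewrite (_ : EFin \o mean_logR a h = mean_log a h)//.
      move: fL1; case: (limn_esup (mean_log a h)) => [l| |]// _.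
      by rewrite -!EFinM -!EFinB -!EFinD lee_fin; lra.
  have [q1 q2 q3 q45 q5] := uv n x xn0; have /andP[q4 q4'] := q45.
  rewrite mul1r.
  have [H _] := stepC h _ _ h8 q3 q45 q5 (vh4 _ q4').
  apply: (le_trans H); rewrite lee_fin ler_expR ler_pM2l//.
  have := ler_wpM2r (ltW hp) q1.
  move: (diffusion_ratio _ _ _ _ _ ^+ 2) ((1 + dA a h n) ^+ 2) => u2 c2' q.
  lra.
- have G := @milstein_growth R d Omega P F W hF hW a f x0 h hf hx0 hp c0 v0 (-1)
    (fu ^+ 2 / 2) (C * Num.sqrt h).
  apply: filterS (G _ _) => [w [B HB]| |n x xn0].
  + rewrite E1 E2.
    apply: le_trans (limn_einf_mean_ge (L := mean_logR a h) (m := mean_inv_sqR a h)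
      (ka := fu ^+ 2 / 2) (e := (C + 1) * Num.sqrt h) (B := B) (A := A) _ LA mA _).
    * rewrite (_ : EFin \o mean_inv_sqR a h = mean_inv_sq a h)// E1.
      rewrite (_ : EFin \o mean_logR a h = mean_log a h)//.
      move: fL2; case: (limn_einf (mean_log a h)) => [l| |]// _.
      by rewrite -?EFinM -?EFinB -?EFinD -?EFinB -?EFinD -?EFinB lee_fin; lra.
    * by rewrite divr_ge0// sqr_ge0.
    * move=> n n0; have [X0 H] := HB n n0.
      by rewrite expE// lee_fin; move: H; rewrite !mulN1r; lra.
  + by rewrite oppr_eq0 oner_neq0.
  have [q1 q2 q3 q45 q5] := uv n x xn0; have /andP[q4 q4'] := q45.
  rewrite mulN1r.
  have [_ H] := stepC h _ _ h8 q3 q45 q5 (vh4 _ q4').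
  apply: (le_trans H); rewrite lee_fin ler_expR ler_pM2l//.
  have := ler_wpM2r (ltW hp) q2.
  move: (diffusion_ratio _ _ _ _ _ ^+ 2) ((1 + dA a h n) ^+ 2) => u2 c2' q.
  lra.
Qed.
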